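(* For any $n,m\ge1$, $$\sum_\lambda\widetilde{\mathsf F}^*_{\lambda'}(u_1,\dots,u_m\mid\Xi,\mathsf{S})\,\mathbb{F}_{\lambda}(\kappa_1,\dots,\kappa_n\mid\Xi,\mathsf{S})=\prod_{i=1}^n\prod_{j=1}^m\frac{1-u_j\kappa_i}{1-u_j\xi_is_i},$$ where the sum is over all partitions $\lambda$.
   Context: Fix a generic parameter $q$, and write $(x;q)_n:=\prod_{i=1}^n(1-xq^{i-1})$, $(x;q)_0:=1$. A partition is a weakly decreasing sequence $\lambda=(\lambda_1\ge\lambda_2\ge\dots\ge0)$ of nonnegative integers with finitely many nonzero entries; $\varnothing$ is the zero partition, $l(\lambda)$ is the number of nonzero parts and $\lambda'$ is the conjugate partition, so the number of parts of $\lambda'$ equal to $j$ is $m_j(\lambda')=\lambda_j-\lambda_{j+1}$. Let $\Xi=(\xi_0,\xi_1,\dots)$ and $\mathsf{S}=(s_0,s_1,\dots)$ be sequences of generic parameters, with fixed square roots $\sqrt{\xi_i},\sqrt{s_i}$. For $k\ge0$ put $s_i^{(k)}:=\sqrt{s_{i+k}\xi_{i+k}s_i/\xi_i}$ (formed from the fixed roots), $\tau^k_{\Xi}\mathsf{S}:=(s^{(k)}_0,s^{(k)}_1,\dots)$. Put $\mathsf{c}_{\mathsf{S}}(\lambda):=\prod_{i\ge1}\frac{(s_i^2;q)_{\lambda_i-\lambda_{i+1}}}{(q;q)_{\lambda_i-\lambda_{i+1}}}$, $(-\mathsf{S})^\lambda:=\prod_{i\ge1}(-s_{i-1})^{\lambda_i}$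 (likewise for other sequences in place of $\mathsf S$). Functions $\mathbb{F}_{\lambda/\mu}$. For $i,j,k,l\in\mathbb{Z}_{\ge0}$ (labels of the bottom, left, top, right edge) let $$W_{t,s}(i,j;k,l):=\mathbf{1}_{i+j=k+l}\,\mathbf{1}_{i\ge l}\,(s^2/t^2)^{l}\frac{(s^2/t^2;q)_{i-l}(t^2;q)_l}{(s^2;q)_i}\frac{(q;q)_i}{(q;q)_{i-l}(q;q)_l}.$$ For $a_1,\dots,a_n\in\mathbb{Z}_{\ge0}$ and $L>l(\lambda),l(\mu)$, $$ZW^{(a_1,\dots,a_n)}_{\lambda/\mu}(\kappa_1,\dots,\kappa_n\mid\Xi,\mathsf{S}):=\sum\prod_{r=1}^n\prod_{c=1}^L W_{t_{r,c},\,s^{(r)}_c}(v_{r,c},h_{r,c-1};v_{r-1,c},h_{r,c}),\qquad t_{r,c}^2=\frac{\xi_{r+c}s_{r+c}}{\kappa_r},$$ the sum being over all nonnegative integers $v_{r,c}$ ($0\le r\le n$, $1\le c\le L$) and $h_{r,c}$ ($1\le r\le n$, $0\le c\le L$) with $v_{0,c}=m_c(\lambda')$, $v_{n,c}=m_c(\mu')$, $h_{r,0}=a_r$, $h_{r,L}=0$ (independent of $L$). Then $$\mathbb{F}_{\lambda/\mu}(\kappa_1,\dots,\kappa_n\mid\Xi,\mathsf{S}):=\frac{(-\tau^n_\Xi\mathsf{S})^{\mu}}{(-\mathsf{S})^{\lambda}}\frac{\mathsf{c}_{\tau^n_\Xi\mathsf{S}}(\mu)}{\mathsf{c}_{\mathsf{S}}(\lambda)}\sum_{a_1+\dots+a_n=\lambda_1-\mu_1}\Bigl(\prod_{i=1}^n(\kappa_is_0/\xi_0)^{a_i}\frac{(\kappa_i^{-1}s_i\xi_i;q)_{a_i}}{(q;q)_{a_i}}\Bigr)ZW^{(a_1,\dots,a_n)}_{\lambda/\mu}(\kappa_1,\dots,\kappa_n\mid\Xi,\mathsf{S}),$$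 and $\mathbb{F}_\lambda:=\mathbb{F}_{\lambda/\varnothing}$. Functions $\widetilde{\mathsf F}^*_{\lambda'/\mu'}$. For $g\in\mathbb{Z}_{\ge0}$ let $w_{u;s}(i,j;k,l)$ ($i,k\in\mathbb{Z}_{\ge0}$ bottom and top labels, $j,l\in\{0,1\}$ left and right labels) be $$w_{u;s}(g,0;g,0)=\frac{1-suq^g}{1-su},\quad w_{u;s}(g,0;g-1,1)=\frac{(q^g-1)su}{1-su},\quad w_{u;s}(g,1;g+1,0)=\frac{1-s^2q^g}{1-su},\quad w_{u;s}(g,1;g,1)=\frac{s^2q^g-su}{1-su},$$ and $0$ otherwise. For $a_1,\dots,a_m\in\{0,1\}$ and $L>l(\lambda),l(\mu)$ let $$Zw^{(a_1,\dots,a_m)}_{\lambda/\mu}(u_1,\dots,u_m\mid\Xi,\mathsf{S}):=\sum\prod_{r=1}^m\prod_{c=1}^L w_{u_r\xi_c;\,s_c}(v_{r,c},h_{r,c-1};v_{r-1,c},h_{r,c}),$$ the sum being over $v_{r,c}\in\mathbb{Z}_{\ge0}$, $h_{r,c}\in\{0,1\}$ with $v_{0,c}=m_c(\lambda')$, $v_{m,c}=m_c(\mu')$, $h_{r,0}=a_r$, $h_{r,L}=0$ (independent of $L$). Set $$\widetilde{\mathsf F}_{\lambda'/\mu'}(u_1,\dots,u_m\mid\Xi,\mathsf{S}):=\frac{(-\mathsf{S})^\mu}{(-\mathsf{S})^\lambda}\frac{\mathsf{c}_{\mathsf{S}}(\mu)}{\mathsf{c}_{\mathsf{S}}(\lambda)}\sum_{a_1,\dots,a_m\in\{0,1\}}\Bigl(\prod_{i=1}^m(-u_i\xi_0s_0)^{a_i}\Bigr)Zw^{(a_1,\dots,a_m)}_{\lambda/\mu}(u_1,\dots,u_m\mid\Xi,\mathsf{S}),$$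 $$\widetilde{\mathsf F}^*_{\lambda'/\mu'}(u_1,\dots,u_m\mid\Xi,\mathsf{S}):=\frac{\mathsf{c}_{\mathsf{S}}(\lambda)}{\mathsf{c}_{\mathsf{S}}(\mu)}\,\widetilde{\mathsf F}_{\lambda'/\mu'}(u_1,\dots,u_m\mid\Xi,\mathsf{S}),$$ and $\widetilde{\mathsf F}^*_{\lambda'}:=\widetilde{\mathsf F}^*_{\lambda'/\varnothing}$. *)

(* Defs.v *)
From HB Require Import structures.
From mathcomp Require Import all_boot all_order all_algebra finmap.
From mathcomp Require Import zify.
From mathcomp Require Import boolp classical_sets functions cardinality fsbigop.

Set Implicit Arguments.
Unset Strict Implicit.
Unset Printing Implicit Defensive.

Import GRing.Theory.

Local Open Scope classical_set_scope.
Local Open Scope ring_scope.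

(* A partition is stored as the list of its nonzero parts, so that [size] is
   the number l(lambda) of nonzero parts. *)
Record intpart := IntPart {
  parts :> seq nat;
  _ : sorted geq parts && (0%N \notin parts) }.
HB.instance Definition _ := [isSub for parts].
HB.instance Definition _ := [Choice of intpart by <:].

Definition empty_part : intpart := @IntPart [::] isT.

(* part lambda i = lambda_{i+1}; it is 0 beyond the nonzero parts. *)
Definition part (lambda : intpart) (i : nat) : nat := nth 0%N lambda i.

(* mconj lambda i = lambda_{i+1} - lambda_{i+2} = m_{i+1}(lambda'). *)
Definition mconj (lambda : intpart) (i : nat) : nat :=
  (part lambda i - part lambda i.+1)%N.

Definition qpoch (F : fieldType) (q x : F) (n : nat) : F :=
  \prod_(i < n) (1 - x * q ^+ i).

(* The entries s_i^{(k)} of tau^k_Xi S, formed from the fixed square roots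
   rXi, rS of Xi and S. *)
Definition tau (F : fieldType) (rXi rS : nat -> F) (k i : nat) : F :=
  rS (i + k)%N * rXi (i + k)%N * rS i / rXi i.

(* c_S(lambda); the factors with i >= l(lambda) equal 1. *)
Definition cS (F : fieldType) (q : F) (S : nat -> F) (lambda : intpart) : F :=
  \prod_(i < size lambda)
     (qpoch q (S i.+1 ^+ 2) (mconj lambda i) / qpoch q q (mconj lambda i)).

(* (-S)^lambda *)
Definition negpow (F : fieldType) (S : nat -> F) (lambda : intpart) : F :=
  \prod_(i < size lambda) (- S i) ^+ part lambda i.

(* In the vertex weights i, j, k, l are the bottom, left, top, right labels. *)

(* W_{t,s}(i,j;k,l), which depends on t only through t2 = t^2. *)
Definition Wfused (F : fieldType) (q t2 s : F) (i j k l : nat) : F :=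
  if (i + j == k + l)%N && (l <= i)%N then
    (s ^+ 2 / t2) ^+ l
    * (qpoch q (s ^+ 2 / t2) (i - l) * qpoch q t2 l / qpoch q (s ^+ 2) i)
    * (qpoch q q i / (qpoch q q (i - l) * qpoch q q l))
  else 0.

Definition wunfused (F : fieldType) (q u s : F) (i j k l : nat) : F :=
  if (j == 0)%N && (l == 0)%N && (k == i) then
    (1 - s * u * q ^+ i) / (1 - s * u)
  else if (j == 0)%N && (l == 1)%N && (i == k.+1) then
    (q ^+ i - 1) * (s * u) / (1 - s * u)
  else if (j == 1)%N && (l == 0)%N && (k == i.+1) then
    (1 - s ^+ 2 * q ^+ i) / (1 - s * u)
  else if (j == 1)%N && (l == 1)%N && (k == i) then
    (s ^+ 2 * q ^+ i - s * u) / (1 - s * u)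
  else 0.

Section Lattice.
Variables (F : fieldType) (n L : nat).

(* Boundary conditions for the edge labels of a lattice with n rows (from top
   to bottom) and L columns.  Rows and columns of vertices are counted from 0:
   [v r c] (0 <= r <= n) is the vertical label v_{r,c+1} and [h r c]
   (0 <= c <= L) is the horizontal label h_{r+1,c}. *)
Definition lattice_config (a : 'I_n -> nat) (lambda mu : intpart) :
    set ('M[nat]_(n.+1, L) * 'M[nat]_(n, L.+1)) :=
  [set vh : 'M[nat]_(n.+1, L) * 'M[nat]_(n, L.+1) |
            [/\ forall c : 'I_L, vh.1 ord0 c = mconj lambda c,
                forall c : 'I_L, vh.1 ord_max c = mconj mu c,
                forall r : 'I_n, vh.2 r ord0 = a r
              & forall r : 'I_n, vh.2 r ord_max = 0%N]].

(* [wt r c] is the weight of the vertex in row r+1 and column c+1. *)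
Definition lattice_weight (wt : 'I_n -> nat -> nat -> nat -> nat -> nat -> F)
    (vh : 'M[nat]_(n.+1, L) * 'M[nat]_(n, L.+1)) : F :=
  \prod_(r < n) \prod_(c < L)
     wt r c (vh.1 (lift ord0 r) c) (vh.2 r (widen_ord (leqnSn L) c))
            (vh.1 (widen_ord (leqnSn n) r) c) (vh.2 r (lift ord0 c)).

(* A sum over all labels in nat; see lattice_sum_finite for its finiteness. *)
Definition lattice_sum (wt : 'I_n -> nat -> nat -> nat -> nat -> nat -> F)
    (a : 'I_n -> nat) (lambda mu : intpart) : F :=
  \sum_(vh \in lattice_config a lambda mu) lattice_weight wt vh.

Let mxbounded m1 m2 B : set 'M[nat]_(m1, m2) :=
  [set A | forall i j, (A i j <= B)%N].

Let finite_mxbounded m1 m2 B : finite_set (@mxbounded m1 m2 B).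
Proof.
pose f (A : 'M['I_B.+1]_(m1, m2)) : 'M[nat]_(m1, m2) :=
  \matrix_(i, j) (A i j : nat).
apply: (@sub_finite_set _ _ (f @` setT)); last exact/finite_image/finite_finset.
move=> A Ab; exists (\matrix_(i, j) inord (A i j)) => //.
by apply/matrixP => i j; rewrite !mxE inordK // ltnS; exact: Ab.
Qed.

Lemma lattice_sum_finite (wt : 'I_n -> nat -> nat -> nat -> nat -> nat -> F)
    (a : 'I_n -> nat) (lambda mu : intpart) :
  (forall r c i j k l, (i + j)%N != (k + l)%N -> wt r c i j k l = 0) ->
  finite_set (lattice_config a lambda mu `&`
              lattice_weight wt @^-1` [set~ 0]).
Proof.
move=> wt0; pose B := (\sum_(c < L) mconj lambda c)%N.
apply: (@sub_finite_set _ _ (@mxbounded n.+1 L B `*` @mxbounded n L.+1 B));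
  last by apply: finite_setX.
move=> [v h] [[/= v0 _ _ hL] /eqP].
rewrite /lattice_weight prodf_seq_neq0 => /allP nz.
have cons (r : 'I_n) (c : 'I_L) :
    (v (lift ord0 r) c + h r (widen_ord (leqnSn L) c))%N
    = (v (widen_ord (leqnSn n) r) c + h r (lift ord0 c))%N.
  have := nz r (mem_index_enum _); rewrite /= prodf_seq_neq0.
  move=> /allP /(_ c (mem_index_enum _)) /= nzrc.
  by apply/eqP; apply: contraNT nzrc => /wt0 ->.
have tail (r : 'I_n) d : (d <= L)%N ->
    (h r (inord (L - d)) + \sum_(c < L | (L - d <= c)%N) v (lift ord0 r) c
     = \sum_(c < L | (L - d <= c)%N) v (widen_ord (leqnSn n) r) c)%N.
  elim: d => [_|d IHd dL].
    rewrite subn0 !big_pred0 => [|c|c]; try by rewrite leqNgt ltn_ord.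
    by rewrite addn0 -(hL r); congr (h r _); apply/val_inj; rewrite /= inordK.
  have kL : (L - d.+1 < L)%N by lia.
  have kS : (L - d)%N = (Ordinal kL).+1 by rewrite /=; lia.
  have IH := IHd (ltnW dL).
  rewrite (bigD1 (Ordinal kL)) //= [RHS](bigD1 (Ordinal kL)) //=.
  have E (f : 'I_L -> nat) :
      (\sum_(c < L | (L - d.+1 <= c)%N && (c != Ordinal kL)) f c
       = \sum_(c < L | (L - d <= c)%N) f c)%N.
    by apply: eq_bigl => c; rewrite -val_eqE /=; lia.
  rewrite !E -IH; have := cons r (Ordinal kL).
  have -> : widen_ord (leqnSn L) (Ordinal kL) = inord (L - d.+1).
    by apply/val_inj; rewrite /= inordK //; lia.
  have -> : lift ord0 (Ordinal kL) = inord (L - d).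
    by apply/val_inj; rewrite /= inordK // /bump /=; lia.
  lia.
have sumB k (kn : (k < n.+1)%N) : (\sum_c v (Ordinal kn) c <= B)%N.
  elim: k kn => [|k IHk] kn.
    rewrite leq_eqVlt; apply/orP; left; apply/eqP/eq_bigr => c _.
    by rewrite -v0; congr (v _ _); apply/val_inj.
  have k1 : (k < n)%N by [].
  have := tail (Ordinal k1) L (leqnn L); rewrite subnn /=.
  have -> : lift ord0 (Ordinal k1) = Ordinal kn by apply/val_inj.
  have -> : widen_ord (leqnSn n) (Ordinal k1) = Ordinal (ltnW kn).
    exact/val_inj.
  move=> E; apply: leq_trans (IHk (ltnW kn)).
  by rewrite -E leq_addl.
split=> /= [[k kn] c|r c].
  by apply: leq_trans (sumB k kn); rewrite (bigD1 c) //= leq_addr.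
have := tail r (L - c)%N (leq_subr _ _).
have cL : (c <= L)%N by rewrite -ltnS ltn_ord.
rewrite subKn // inord_val => E.
have rn : (r < n.+1)%N by apply: ltnW; rewrite ltnS ltn_ord.
apply: leq_trans (sumB r rn).
have <- : widen_ord (leqnSn n) r = Ordinal rn by apply/val_inj.
rewrite (bigID (fun i : 'I_L => (c <= i)%N)) /=.
by rewrite -E -addnA leq_addr.
Qed.
End Lattice.

Section Functions.
Variables (F : fieldType) (q : F) (Xi S rXi rS : nat -> F).

(* The least L with L > l(lambda) and L > l(mu); the lattice sums below do not
   depend on the choice of such an L. *)
Definition ncols (lambda mu : intpart) : nat :=
  (maxn (size lambda) (size mu)).+1.

(* The variables kappa, u and the labels a are indexed from 0, so the vertex
   (r, c) below sits in row r+1 and column c+1: it has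
   t^2 = xi_{r+c+2} s_{r+c+2} / kappa_{r+1} and s = s^{(r+1)}_{c+1}. *)
Definition ZW n (kappa : 'I_n -> F) (a : 'I_n -> nat) (lambda mu : intpart) :
    F :=
  @lattice_sum F n (ncols lambda mu)
    (fun r c => Wfused q (Xi (r.+1 + c.+1)%N * S (r.+1 + c.+1)%N / kappa r)
                         (tau rXi rS r.+1 c.+1))
    a lambda mu.

(* F_{lambda/mu}; the bound a_i <= lambda_1 is implied by
   a_1 + ... + a_n = lambda_1 - mu_1. *)
Definition FF n (kappa : 'I_n -> F) (lambda mu : intpart) : F :=
  negpow (tau rXi rS n) mu / negpow S lambda
  * (cS q (tau rXi rS n) mu / cS q S lambda)
  * \sum_(a : {ffun 'I_n -> 'I_(part lambda 0).+1}
           | (\sum_i a i + part mu 0 == part lambda 0)%N)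
      (\prod_(i < n)
          ((kappa i * S 0%N / Xi 0%N) ^+ a i
           * (qpoch q ((kappa i)^-1 * S i.+1 * Xi i.+1) (a i)
              / qpoch q q (a i))))
      * ZW kappa (fun i => a i) lambda mu.

Definition Zw m (u : 'I_m -> F) (a : 'I_m -> nat) (lambda mu : intpart) : F :=
  @lattice_sum F m (ncols lambda mu)
    (fun r c => wunfused q (u r * Xi c.+1) (S c.+1)) a lambda mu.

(* F~_{lambda'/mu'} and F~^*_{lambda'/mu'}, as functions of lambda and mu. *)
Definition Ftilde m (u : 'I_m -> F) (lambda mu : intpart) : F :=
  negpow S mu / negpow S lambda * (cS q S mu / cS q S lambda)
  * \sum_(a : {ffun 'I_m -> bool})
      (\prod_(i < m) (- (u i * Xi 0%N * S 0%N)) ^+ a i)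
      * Zw u (fun i => a i : nat) lambda mu.

Definition Ftilde_star m (u : 'I_m -> F) (lambda mu : intpart) : F :=
  cS q S lambda / cS q S mu * Ftilde u lambda mu.

End Functions.

(* Main.v *)
Require Import Defs.
From mathcomp Require Import all_boot all_order all_algebra finmap.
From mathcomp Require Import zify ring.
From mathcomp Require Import boolp classical_sets functions cardinality fsbigop.

(* After a diagonal change of gauge the parameters enter only through
   x_i = xi_{i+1} s_{i+1} and y_i = s_{i+1} / xi_{i+1}; passing to the next row
   of F shifts x and keeps y.  Write T_k(l, m) and D_u(l, n) for the one-row
   functions.  The key is the exchange relation (skew Cauchy identity)
     sum_l D_u^x(l, n) T_k^(x,y)(l, m)
       = (1 - u k) / (1 - u x_0) sum_r T_k^(x,y)(n, r) D_u^(shift x)(m, r).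
   Here l arises from n by raising some parts by one, and r from m by lowering
   some parts by one, so each side is a product over the columns of 2x2
   transfer matrices; an explicit matrix depending only on the difference of
   the corresponding parts of n and m intertwines the two products.  Moving
   all D-rows through all T-rows produces the double product, and only the
   empty partition survives at the end. *)

(** What shapes the proof is the boundary bookkeeping. Labels are differences of natural numbers
    with truncated subtraction and [q] may be 0, so ratios of neighbouring weights need not exist:
    recursions are cross-multiplied, and an identity valid only for interlacing parts is multiplied
    by a weight that vanishes otherwise. The factor 1 - u k is an eigenvalue: the left boundary
    contributes the row vector (E0, - u E1) of edge factors, a left eigenvector of the intertwining
    matrix. No infinite sum is needed. A row T removes at most one nonzero part and a row D lowers
    the first part by at most one, so only partitions with at most n parts, all at most m,
    contribute. All sums run over zero-padded lists in a finite box, and strict bounds [a < B] leave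
    room for raising a part. The gauge consists of powers of [Xi i * S i] for D and of [S i / Xi i]
    for T. Their product is a power of [S i ^+ 2], which cancels the two prefactors
    1/(-S)^lambda. *)

Set Implicit Arguments.
Unset Strict Implicit.
Unset Printing Implicit Defensive.

Import GRing.Theory.

Local Open Scope classical_set_scope.
Local Open Scope ring_scope.

(** * The exchange relation *)

(* The inductive step of [exchange_columns]: [p], [p1], [Q], [Q'] stand for
   q^P, q^(P-1), q^(d+1), q^(d'+1) and [z], [z'] for x q^d, x' q^d'.  Since [q]
   may be 0, no relation such as [p = q * p1] is assumed. *)
Section ExchangeAlgebra.
Variables (F : fieldType) (u k x x' y z z' p p1 Q Q' C A0 A1 E0 E1 : F).
Variables (l0 l1 r0 r1 L R0 R1 : F).
Hypotheses (x'_neq : 1 - u * x' != 0)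
  (HA : A0 * (1 - p) = A1 * (1 - k * y * p1))
  (HE : E0 * (k - z') = E1 * (1 - Q'))
  (Hl0 : E0 * ((1 - u * x') * l0)
         = E0 * ((1 - u * z') * r0 - u * (k - z') * r1))
  (Hl1 : E1 * ((1 - u * x') * l1) = E1 * ((1 - Q') * r0 + (Q' - u * k) * r1))
  (HR0 : (1 - u * x') * R0
         = C * (A0 * (1 - u * (z' * p)) * E0 * r0
                - u * A0 * (1 - p * Q') * E1 * r1))
  (HR1 : (1 - u * x') * R1
         = C * (A1 * (1 - z' * y * p1) * E0 * r0
                + A1 * (y * (p1 * Q') - u) * E1 * r1)).

Lemma exchange_column0 :
  (1 - u * x) * L = C * (A0 * (1 - u * (z * p)) * E0 * l0
                         - u * A1 * (1 - z * y * p1) * E1 * l1) ->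
  (1 - u * x) * L = (1 - u * z) * R0 - u * (k - z) * R1.
Proof.
move=> HL; apply: (mulfI x'_neq); apply/eqP; rewrite -subr_eq0.
(* An explicit certificate: the difference of the two sides is a combination of the defects of the
   seven assumed relations. [ring] checks it, and each defect is zero. *)
have -> : (1 - u * x') * ((1 - u * x) * L)
          - (1 - u * x') * ((1 - u * z) * R0 - u * (k - z) * R1)
  = (1 - u * x') * ((1 - u * x) * L
       - C * (A0 * (1 - u * (z * p)) * E0 * l0
              - u * A1 * (1 - z * y * p1) * E1 * l1))
    + C * A0 * (1 - u * z * p) * (E0 * ((1 - u * x') * l0)
        - E0 * ((1 - u * z') * r0 - u * (k - z') * r1))
    - C * u * A1 * (1 - z * y * p1) * (E1 * ((1 - u * x') * l1)
        - E1 * ((1 - Q') * r0 + (Q' - u * k) * r1))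
    - (1 - u * z) * ((1 - u * x') * R0
         - C * (A0 * (1 - u * (z' * p)) * E0 * r0
                - u * A0 * (1 - p * Q') * E1 * r1))
    + u * (k - z) * ((1 - u * x') * R1
         - C * (A1 * (1 - z' * y * p1) * E0 * r0
                + A1 * (y * (p1 * Q') - u) * E1 * r1))
    + C * (u * A1 * (1 - z * y * p1) * r0 - u * A0 * (1 - u * z * p) * r1)
      * (E0 * (k - z') - E1 * (1 - Q'))
    + C * (E0 * r0 * u * (z - z') - u * E1 * r1 * (u * z - Q'))
      * (A0 * (1 - p) - A1 * (1 - k * y * p1)) by ring.
by rewrite HA HE Hl0 Hl1 HR0 HR1 HL !subrr !mulr0 !addr0 !subr0.
Qed.

Lemma exchange_column1 :
  (1 - u * x) * L = C * (A0 * (1 - p * Q) * E0 * l0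
                         + A1 * (y * (p1 * Q) - u) * E1 * l1) ->
  (1 - u * x) * L = (1 - Q) * R0 + (Q - u * k) * R1.
Proof.
move=> HL; apply: (mulfI x'_neq); apply/eqP; rewrite -subr_eq0.
have -> : (1 - u * x') * ((1 - u * x) * L)
          - (1 - u * x') * ((1 - Q) * R0 + (Q - u * k) * R1)
  = (1 - u * x') * ((1 - u * x) * L
       - C * (A0 * (1 - p * Q) * E0 * l0
                         + A1 * (y * (p1 * Q) - u) * E1 * l1))
    + C * A0 * (1 - p * Q) * (E0 * ((1 - u * x') * l0)
        - E0 * ((1 - u * z') * r0 - u * (k - z') * r1))
    + C * A1 * (y * p1 * Q - u) * (E1 * ((1 - u * x') * l1)
        - E1 * ((1 - Q') * r0 + (Q' - u * k) * r1))
    - (1 - Q) * ((1 - u * x') * R0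
         - C * (A0 * (1 - u * (z' * p)) * E0 * r0
                - u * A0 * (1 - p * Q') * E1 * r1))
    - (Q - u * k) * ((1 - u * x') * R1
         - C * (A1 * (1 - z' * y * p1) * E0 * r0
                + A1 * (y * (p1 * Q') - u) * E1 * r1))
    - C * (A1 * (y * p1 * Q - u) * r0 + u * A0 * (1 - p * Q) * r1)
      * (E0 * (k - z') - E1 * (1 - Q'))
    + C * (E0 * r0 * (Q - u * z') + u * E1 * r1 * (Q' - Q))
      * (A0 * (1 - p) - A1 * (1 - k * y * p1)) by ring.
by rewrite HA HE Hl0 Hl1 HR0 HR1 HL !subrr !mulr0 !addr0 !subr0.
Qed.

End ExchangeAlgebra.

(** * Finite boxes of lists and two-term sums *)

Local Notation entry := (nth 0%N).

(** Not restricted to decreasing lists, so that a sum peels off its first entry freely; [big_states]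
    passes to decreasing lists once the summand vanishes on the others. *)
Fixpoint lists (L B : nat) : seq (seq nat) :=
  if L is L'.+1 then [seq a :: l | a <- iota 0 B.+1, l <- lists L' B]
  else [:: [::]].

Lemma mem_lists L B s :
  (s \in lists L B) = (size s == L) && all (fun a => a <= B)%N s.
Proof.
elim: L s => [|L IH] s; first by case: s.
apply/allpairsP/idP => [[[a l] [+ + ->]]|].
  rewrite mem_iota IH [size _]/= ltnS eqSS => /andP[_ aB] /andP[sL lB].
  by apply/and3P.
case: s => // a l; rewrite [size _]/= eqSS => /andP[sL /andP[aB lB]].
by exists (a, l); rewrite ?mem_iota ?IH ?ltnS ?sL.
Qed.

Lemma lists_uniq L B : uniq (lists L B).
Proof.
elim: L => // L IH; apply: allpairs_uniq => //; first exact: iota_uniq.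
by move=> [a l] [b m] _ _ /= [-> ->].
Qed.

Lemma big_lists (F : fieldType) L B (f : seq nat -> F) :
  \sum_(s <- lists L.+1 B) f s
  = \sum_(a <- iota 0 B.+1) \sum_(s <- lists L B) f (a :: s).
Proof. by rewrite big_allpairs_dep. Qed.

(** For a part that is kept or raised by one; [n < B] keeps the raised value in the range. *)
Lemma big_iota_pair (F : fieldType) B n (f : nat -> F) : (n < B)%N ->
  (forall a, a != n -> a != n.+1 -> f a = 0) ->
  \sum_(a <- iota 0 B.+1) f a = f n + f n.+1.
Proof.
move=> nB f0; have n1 : n \in iota 0 B.+1 by rewrite mem_iota; lia.
have n2 : n.+1 \in iota 0 B.+1 by rewrite mem_iota; lia.
rewrite (bigD1_seq n n1 (iota_uniq _ _)) big_mkcond.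
rewrite (bigD1_seq n.+1 n2 (iota_uniq _ _)) (_ : (n.+1 != n)%N = true); last by lia.
rewrite big1 /= ?addr0 // => a an; case: eqP => // /eqP a1; exact: f0.
Qed.

(** For a part that is kept or lowered by one; a zero part cannot be lowered, whence the zero
    branch. *)
Lemma big_iota_pred (F : fieldType) B m (f : nat -> F) : (m <= B)%N ->
  (forall a, a != m -> a.+1 != m -> f a = 0) ->
  \sum_(a <- iota 0 B.+1) f a = f m + (if m is m'.+1 then f m' else 0).
Proof.
case: m => [|m] mB f0.
  have n0 : 0%N \in iota 0 B.+1 by rewrite mem_iota.
  by rewrite (bigD1_seq 0%N n0 (iota_uniq _ _)) big1 // => a a0; exact: f0.
by rewrite (@big_iota_pair _ _ m) 1?addrC // => a a1 a2; apply: f0.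
Qed.

(** * One-row functions and their column transfer matrices *)

Section RowFunctions.
Variables (F : fieldType) (q : F).
Implicit Types (nu mu : seq nat).

Definition qratio (a : F) n := qpoch q a n / qpoch q q n.

(* For b <= a, [Fedge] is k^d (x/k; q)_d / (q; q)_d with d = a - b.  [Frow] is
   a one-row function F_{l/m} up to the gauge factors of [Frow_row_weight]: the
   denominators (s^2; q) of the fused weights cancel against those of c_S. *)
Definition Fedge (k x : F) (a b : nat) : F :=
  if (b <= a)%N then \prod_(i < a - b) ((k - x * q ^+ i) / (1 - q ^+ i.+1))
  else 0.

(** The zero branch imposes [a' <= b], the half of the interlacing condition that [Fedge] does not
    see. *)
Definition Fcol (k x y : F) (a a' b : nat) : F :=
  (if (a' <= b)%N then qratio (k * y) (b - a') else 0)
  / qratio (x * y) (a - a').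

Definition Frow (k : F) (x y : nat -> F) (l m : seq nat) : F :=
  \prod_(c < size l)
     (Fedge k (x c) (entry l c) (entry m c)
      * Fcol k (x c) (y c) (entry l c) (entry l c.+1) (entry m c)).

(* The weight [wunfused] for s^2 = x y, divided by x^l. *)
Definition Dvertex (u x y : F) (i j k l : nat) : F :=
  if (j == 0)%N && (l == 0)%N && (k == i) then
    (1 - u * x * q ^+ i) / (1 - u * x)
  else if (j == 0)%N && (l == 1)%N && (i == k.+1) then
    (q ^+ i - 1) * u / (1 - u * x)
  else if (j == 1)%N && (l == 0)%N && (k == i.+1) then
    (1 - x * y * q ^+ i) / (1 - u * x)
  else if (j == 1)%N && (l == 1)%N && (k == i) then
    (y * q ^+ i - u) / (1 - u * x)
  else 0.

(** Without the guard, truncated subtraction would read [a < b] as left label 0. The right label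
    needs no guard, being the left label of the next column. *)
Definition Dcol (u x y : F) (a a' b b' : nat) : F :=
  if (b <= a)%N then Dvertex u x y (b - b') (a - b) (a - a') (a' - b') else 0.

Definition Dprod (u : F) (x y : nat -> F) (l m : seq nat) : F :=
  \prod_(c < size l)
     Dcol u (x c) (y c) (entry l c) (entry l c.+1) (entry m c) (entry m c.+1).

Definition Drow (u : F) (x y : nat -> F) (l m : seq nat) : F :=
  (- u) ^+ ((entry l 0) - (entry m 0)) * Dprod u x y l m.

Definition shift (x : nat -> F) : nat -> F := fun i => x i.+1.

Lemma Frow_cons k x y a l b m :
  Frow k x y (a :: l) (b :: m)
  = Fedge k (x 0%N) a b * Fcol k (x 0%N) (y 0%N) a (entry l 0) b
    * Frow k (shift x) (shift y) l m.
Proof. by rewrite /Frow big_ord_recl. Qed.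

Lemma Dprod_cons u x y a l b m :
  Dprod u x y (a :: l) (b :: m)
  = Dcol u (x 0%N) (y 0%N) a (entry l 0) b (entry m 0)
    * Dprod u (shift x) (shift y) l m.
Proof. by rewrite /Dprod big_ord_recl. Qed.

Lemma Dcol_right u (x y : F) a a' b b' : (a' - b' > 1)%N -> Dcol u x y a a' b b' = 0.
Proof.
rewrite /Dcol /Dvertex; case: (leqP b a) => // _.
by case: (a' - b')%N => [|[|d]] //= _; rewrite !andbF.
Qed.

Lemma Dcol_left u (x y : F) a a' b b' : (a - b > 1)%N -> Dcol u x y a a' b b' = 0.
Proof.
rewrite /Dcol /Dvertex; case: (leqP b a) => // _.
by case: (a - b)%N => [|[|d]].
Qed.

Lemma Dcol00 u (x y : F) n n' : (n' <= n)%N ->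
  Dcol u x y n n' n n' = (1 - u * x * q ^+ (n - n')) / (1 - u * x).
Proof. by move=> h; rewrite /Dcol leqnn /Dvertex !subnn !eqxx. Qed.

(** For [n = n'], raising only the second part would break the order; the factor [q ^+ 0 - 1] is
    then zero, so one formula covers all cases. *)
Lemma Dcol01 u (x y : F) n n' : (n' <= n)%N ->
  Dcol u x y n n'.+1 n n' = (q ^+ (n - n') - 1) * u / (1 - u * x).
Proof.
move=> h; rewrite /Dcol leqnn /Dvertex subnn subSnn /=.
case: eqP => // ne; have -> : (n - n' = 0)%N by lia.
by rewrite expr0 subrr !mul0r.
Qed.

Lemma Dcol10 u (x y : F) n n' : (n' <= n)%N ->
  Dcol u x y n.+1 n' n n' = (1 - x * y * q ^+ (n - n')) / (1 - u * x).
Proof.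
move=> h; rewrite /Dcol leqnSn /Dvertex subnn subSnn /=.
by rewrite subSn // eqxx.
Qed.

Lemma Dcol11 u (x y : F) n n' : (n' <= n)%N ->
  Dcol u x y n.+1 n'.+1 n n' = (y * q ^+ (n - n') - u) / (1 - u * x).
Proof.
by move=> h; rewrite /Dcol leqnSn /Dvertex !subSnn subSS eqxx.
Qed.

Hypothesis q_gen : forall i, q ^+ i.+1 != 1.

Lemma subr1q_neq0 i : 1 - q ^+ i.+1 != 0.
Proof. by rewrite subr_eq0 eq_sym. Qed.

Lemma qpoch0 a : qpoch q a 0 = 1.
Proof. by rewrite /qpoch big_ord0. Qed.

Lemma qpochS a n : qpoch q a n.+1 = qpoch q a n * (1 - a * q ^+ n).
Proof. by rewrite /qpoch big_ord_recr. Qed.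

Lemma qratio0 a : qratio a 0 = 1.
Proof. by rewrite /qratio !qpoch0 divr1. Qed.

Lemma qratioS a n :
  qratio a n.+1 = qratio a n * ((1 - a * q ^+ n) / (1 - q ^+ n.+1)).
Proof. by rewrite /qratio !qpochS -exprS mulf_div. Qed.

Lemma qpochqq_neq0 n : qpoch q q n != 0.
Proof.
elim: n => [|n IH]; first by rewrite qpoch0 oner_neq0.
by rewrite qpochS mulf_neq0 // -exprS subr1q_neq0.
Qed.

Lemma qpoch_neq0 a n : (forall i, a * q ^+ i != 1) -> qpoch q a n != 0.
Proof.
move=> a1; elim: n => [|n IH]; first by rewrite qpoch0 oner_neq0.
by rewrite qpochS mulf_neq0 // subr_eq0 eq_sym.
Qed.

Lemma qratio_neq0 a n : (forall i, a * q ^+ i != 1) -> qratio a n != 0.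
Proof. by move=> a1; rewrite mulf_neq0 ?invr_neq0 ?qpochqq_neq0 ?qpoch_neq0. Qed.

(** The ratio of consecutive edge factors, cross-multiplied to include [m = n.+1], where
    [Fedge q k x n m] and [1 - q ^+ 0] are both zero. *)
Lemma Fedge_rec k (x : F) (n m : nat) : (m <= n.+1)%N ->
  Fedge k x n m * (k - x * q ^+ (n - m))
  = Fedge k x n.+1 m * (1 - q ^+ (n.+1 - m)).
Proof.
rewrite /Fedge => h; rewrite h; case: leqP => h'.
  rewrite subSn // big_ord_recr /= -mulrA mulfVK //; exact: subr1q_neq0.
by rewrite (_ : n.+1 - m = 0)%N ?expr0 ?subrr ?mulr0 ?mul0r //; lia.
Qed.

Lemma Fedge_neq0 k (x : F) a b : Fedge k x a b != 0 -> (b <= a)%N.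
Proof. by rewrite /Fedge; case: leqP => //; rewrite eqxx. Qed.

Lemma Fcol_neq0 k (x y : F) a a' b : Fcol k x y a a' b != 0 -> (a' <= b)%N.
Proof. by rewrite /Fcol; case: leqP => //; rewrite mul0r eqxx. Qed.

(* The sums over the entries to the right of a fixed column on the two sides
   of the exchange relation, the first edge factor being left out. *)
Definition lsum (B : nat) (u k : F) (x y : nat -> F) (n : nat) nu (m : nat) mu (a : nat) : F :=
  \sum_(l <- lists (size nu) B)
     Dprod u x y (a :: l) (n :: nu)
     * (Fcol k (x 0%N) (y 0%N) a (entry l 0) m
        * Frow k (shift x) (shift y) l mu).

Definition rsum (B : nat) (u k : F) (x y : nat -> F) (n : nat) nu (m : nat) mu (b : nat) : F :=
  \sum_(r <- lists (size nu) B)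
     (Fcol k (x 0%N) (y 0%N) n (entry nu 0) b
      * Frow k (shift x) (shift y) nu r)
     * Dprod u (shift x) y (m :: mu) (b :: r).

Lemma lsum_out B u k x y n nu (m : nat) mu a :
  (a < n)%N || (n.+1 < a)%N -> lsum B u k x y n nu m mu a = 0.
Proof.
move=> h; apply: big1 => l _; rewrite Dprod_cons.
suff -> : Dcol u (x 0%N) (y 0%N) a (entry l 0) n (entry nu 0) = 0.
  by rewrite !mul0r.
case/orP: h => h; last by apply: Dcol_left; lia.
by rewrite /Dcol leqNgt h.
Qed.

Lemma rsum_out B u k x y n nu (m : nat) mu b :
  (m < b)%N || (b.+1 < m)%N -> rsum B u k x y n nu m mu b = 0.
Proof.
move=> h; apply: big1 => r _; rewrite Dprod_cons.
suff -> : Dcol u (shift x 0) (y 0%N) m (entry mu 0) b (entry r 0) = 0.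
  by rewrite mul0r mulr0.
case/orP: h => h; last by apply: Dcol_left; lia.
by rewrite /Dcol leqNgt h.
Qed.

Lemma lsum_cons B u k x y n n' nu (m m' : nat) mu a : (n' < B)%N ->
  let f e := Dcol u (x 0%N) (y 0%N) a e n n' * Fcol k (x 0%N) (y 0%N) a e m
      * Fedge k (x 1%N) e m' * lsum B u k (shift x) (shift y) n' nu m' mu e in
  lsum B u k x y n (n' :: nu) m (m' :: mu) a = f n' + f n'.+1.
Proof.
move=> n'B f; rewrite -(@big_iota_pair _ B n' f) //.
  rewrite /lsum [size _]/= big_lists; apply: eq_bigr => e _; rewrite /f mulr_sumr.
  apply: eq_bigr => l _.
  by rewrite Frow_cons Dprod_cons /shift /=; ring.
move=> e en en1; rewrite /f; case: (ltnP e n') => h; first by rewrite lsum_out ?mulr0 // h.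
by rewrite Dcol_right ?mul0r //; lia.
Qed.

Lemma rsum_cons B u k x y n n' nu (m m' : nat) mu b : (m' <= B)%N ->
  let f e := Fcol k (x 0%N) (y 0%N) n n' b * Fedge k (x 1%N) n' e
      * Dcol u (x 1%N) (y 0%N) m m' b e
      * rsum B u k (shift x) (shift y) n' nu m' mu e in
  rsum B u k x y n (n' :: nu) m (m' :: mu) b
  = f m' + (if m' is e.+1 then f e else 0).
Proof.
move=> m'B f; rewrite -(@big_iota_pred _ B m' f) //.
  rewrite /rsum [size _]/= big_lists; apply: eq_bigr => e _; rewrite /f mulr_sumr.
  apply: eq_bigr => l _.
  by rewrite Frow_cons Dprod_cons /shift /=; ring.
by move=> e em em1; rewrite /f rsum_out ?mulr0 //; lia.
Qed.

End RowFunctions.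

(** * Intertwining the transfer matrices column by column *)

Section ExchangeColumns.
Variables (F : fieldType) (q : F).
Hypothesis q_gen : forall i, q ^+ i.+1 != 1.

Lemma qratioVS (a : F) n : 1 - a * q ^+ n != 0 ->
  (1 - a * q ^+ n) / qratio q a n.+1 = (1 - q ^+ n.+1) / qratio q a n.
Proof.
move=> an; rewrite qratioS invfM.
have := subr1q_neq0 q_gen n; move: an.
move: (qratio q a n)^-1 (1 - a * q ^+ n) (1 - q ^+ n.+1) => c b d b0 d0.
by rewrite invf_div mulrCA [b * _]mulrC divfK // mulrC.
Qed.

(** At [b = a'] the left side vanishes through [1 - q ^+ 0] and the right side through its guard, so
    the predecessor of 0 does no harm. *)
Lemma column_weight_rec (a : F) b a' : (a' <= b)%N ->
  (if (a' <= b)%N then qratio q a (b - a') else 0) * (1 - q ^+ (b - a'))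
  = (if (a' < b)%N then qratio q a (b - a').-1 else 0)
    * (1 - a * q ^+ (b - a').-1).
Proof.
move=> h; rewrite h; case: ltnP => h'.
  rewrite -[in LHS](ltn_predK (_ : 0 < b - a'))%N; last by lia.
  rewrite qratioS -mulrA mulfVK //; exact: subr1q_neq0.
by rewrite (_ : b - a' = 0)%N ?expr0 ?subrr ?mulr0 ?mul0r //; lia.
Qed.

(** [Fedge] depends only on the difference of its parts, so lowering [m'] on this side yields
    [Fedge q k (x 1%N) n'.+1 m'], the factor that raising [n'] yields on the other side. *)
Lemma rsum_cons_stay B (u k : F) (x y : nat -> F) n n' nu m m' mu :
  (m' <= B)%N -> (m' <= m)%N ->
  rsum q B u k x y n (n' :: nu) m (m' :: mu) m
  = (1 - u * x 1%N * q ^+ (m - m')) / (1 - u * x 1%N)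
      * Fcol q k (x 0%N) (y 0%N) n n' m * Fedge q k (x 1%N) n' m'
      * rsum q B u k (shift x) (shift y) n' nu m' mu m'
    + (q ^+ (m.+1 - m') - 1) * u / (1 - u * x 1%N)
      * Fcol q k (x 0%N) (y 0%N) n n' m * Fedge q k (x 1%N) n'.+1 m'
      * (if m' is e.+1 then rsum q B u k (shift x) (shift y) n' nu m' mu e
         else 0).
Proof.
move=> m'B m'm; rewrite rsum_cons // Dcol00 //; congr (_ + _); first by ring.
case: m' m'B m'm => [|e] _ m'm; first by rewrite mulr0.
by rewrite Dcol01 1?ltnW // /Fedge !subSS ltnS; ring.
Qed.

(** The first [Dcol] stays unevaluated because [m' = m.+1] is allowed and [Dcol10] does not apply
    there; [exchange_columns] evaluates it behind a product that is zero in that case. *)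
Lemma rsum_cons_step B (u k : F) (x y : nat -> F) n n' nu m m' mu :
  (m' <= B)%N -> (m' <= m.+1)%N ->
  rsum q B u k x y n (n' :: nu) m.+1 (m' :: mu) m
  = Dcol q u (x 1%N) (y 0%N) m.+1 m' m m'
      * Fcol q k (x 0%N) (y 0%N) n n' m * Fedge q k (x 1%N) n' m'
      * rsum q B u k (shift x) (shift y) n' nu m' mu m'
    + (y 0%N * q ^+ (m.+1 - m') - u) / (1 - u * x 1%N)
      * Fcol q k (x 0%N) (y 0%N) n n' m * Fedge q k (x 1%N) n'.+1 m'
      * (if m' is e.+1 then rsum q B u k (shift x) (shift y) n' nu m' mu e
         else 0).
Proof.
move=> m'B m'm; rewrite rsum_cons //; congr (_ + _); first by ring.
case: m' m'B m'm => [|e] _ m'm; first by rewrite mulr0.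
by rewrite Dcol11 // /Fedge !subSS ltnS; ring.
Qed.

Lemma cancel_common_den (d a b e l a' b' e' l' : F) : d != 0 ->
  d * (a / d * b * e * l + a' / d * b' * e' * l')
  = a * b * e * l + a' * b' * e' * l'.
Proof. by move=> d0; field. Qed.

(* With d = n - m and z = x_0 q^d, the matrix
     [[1 - u z, - u (k - z)], [1 - q^(d+1), q^(d+1) - u k]]
   intertwines the column transfer matrices of the two sides.  The index [1]
   of [r1] stands for a part [m] lowered by one, and the first (second)
   relation is only meaningful for d >= 0 (d >= -1). *)
Lemma exchange_columns B (u k : F) (x y : nat -> F) n nu m mu :
  (forall i, 1 - u * x i != 0) ->
  (forall i j, x i * y i * q ^+ j != 1) ->
  size mu = size nu -> sorted geq (n :: nu) -> sorted geq (m :: mu) ->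
  all (fun a => a < B)%N nu -> all (fun a => a <= B)%N mu -> last m mu = 0%N ->
  let r0 := rsum q B u k x y n nu m mu m in
  let r1 := if m is m'.+1 then rsum q B u k x y n nu m mu m' else 0 in
  let l := lsum q B u k x y n nu m mu in
  ((m <= n)%N -> (1 - u * x 0%N) * l n
     = (1 - u * (x 0%N * q ^+ (n - m))) * r0
       - u * (k - x 0%N * q ^+ (n - m)) * r1) /\
  ((m <= n.+1)%N -> (1 - u * x 0%N) * l n.+1
     = (1 - q ^+ (n.+1 - m)) * r0 + (q ^+ (n.+1 - m) - u * k) * r1).
Proof.
elim: nu n m mu x y => [|n' nu IH] n m [|m' mu] x y ux xy //.
  (* A single column is left: [last m mu = 0] forces [m = 0], so nothing can be lowered and [r1] is
     zero. *)
  move=> _ _ _ _ _ /= -> /=; rewrite !subn0.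
  rewrite /lsum /rsum /= !big_seq1 !Dprod_cons /Dprod /Frow /= !big_ord0.
  rewrite Dcol00 // Dcol10 // Dcol00 // subnn /Fcol leqnn !subnn !subn0 qratio0.
  rewrite expr0 !mulr1 !mul1r (divff (ux 1%N)) mulr1 !mulr0 subr0 addr0.
  have K (a c : F) : (1 - u * x 0%N) * (a / (1 - u * x 0%N) * c) = a * c.
    by rewrite mulrA [_ * (a / _)]mulrC divfK.
  rewrite !K mulrA; split=> // _; apply: qratioVS => //.
  by rewrite subr_eq0 eq_sym.
move=> /eqP; rewrite [size _]/= [size (_ :: nu)]/= eqSS => /eqP sz /andP[n'n sn].
move=> /andP[m'm sm] /andP[n'B nB] /andP[m'B mB] lm r0 r1 l.
have {IH} := IH n' m' mu (shift x) (shift y) (fun i => ux i.+1)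
  (fun i => xy i.+1) sz sn sm nB mB lm.
set R0' := rsum _ _ _ _ _ _ _ _ _ _ m'.
set R1' := (if m' is _.+1 then _ else _); set L' := lsum _ _ _ _ _ _ n' _ _ _.
rewrite -[shift x 0%N]/(x 1%N) => -[IH0 IH1].
(* [A0], [A1] are numerators of [Fcol], depending on [m - n'] only, and [E0], [E1] are edge factors,
   depending on [n' - m'] only. Raising [n'] on the left and lowering [m] or [m'] on the right
   therefore lead to the same [A1] and [E1]. *)
pose C := (qratio q (x 0%N * y 0%N) (n - n'))^-1.
pose A0 := if (n' <= m)%N then qratio q (k * y 0%N) (m - n') else 0.
pose A1 := if (n' < m)%N then qratio q (k * y 0%N) (m - n').-1 else 0.
pose E0 := Fedge q k (x 1%N) n' m'; pose E1 := Fedge q k (x 1%N) n'.+1 m'.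
pose p := q ^+ (m - n'); pose p1 := q ^+ (m - n').-1.
pose z' := x 1%N * q ^+ (n' - m'); pose Q' := q ^+ (n'.+1 - m').
have HA : A0 * (1 - p) = A1 * (1 - k * y 0%N * p1).
  rewrite /A0 /A1; case: (leqP n' m) => h; last by rewrite ltnNge (ltnW h) !mul0r.
  by have := column_weight_rec (k * y 0%N) h; rewrite h.
have HE : E0 * (k - z') = E1 * (1 - Q').
  case: (leqP m' n'.+1) => h; first exact: Fedge_rec.
  by rewrite /E0 /E1 /Fedge leqNgt ltnW // leqNgt h /= !mul0r.
(* The induction hypotheses need [m' <= n'], respectively [m' <= n'.+1]; multiplied by the edge
   factor that vanishes otherwise, they hold unconditionally. *)
have Hl0 : E0 * ((1 - u * x 1%N) * L' n')
           = E0 * ((1 - u * z') * R0' - u * (k - z') * R1').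
  have [->|/Fedge_neq0 h] := eqVneq E0 0; first by rewrite !mul0r.
  by rewrite IH0.
have Hl1 : E1 * ((1 - u * x 1%N) * L' n'.+1)
           = E1 * ((1 - Q') * R0' + (Q' - u * k) * R1').
  have [->|/Fedge_neq0 h] := eqVneq E1 0; first by rewrite !mul0r.
  by rewrite IH1.
have HR0 : (1 - u * x 1%N) * r0 = C * (A0 * (1 - u * (z' * p)) * E0 * R0'
                - u * A0 * (1 - p * Q') * E1 * R1').
  rewrite /r0 rsum_cons_stay // cancel_common_den // -/R1' -/R0' -/E0 -/E1.
  (* The exponents add up only for [m' <= n' <= m]; outside this range [E0] or [A0] is zero. The
     later [Ep] and [Eq] rest on similar vanishing. *)
  have Ep : A0 * E0 * (x 1%N * q ^+ (m - m')) = A0 * E0 * (z' * p).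
    have [->|/Fedge_neq0 h] := eqVneq E0 0; first by rewrite mulr0 !mul0r.
    rewrite /A0 /z' /p; case: leqP => h'; last by rewrite !mul0r.
    by rewrite -[x 1%N * _ * _]mulrA -exprD; do 2!congr (_ * _); congr (_ ^+ _); lia.
  have Eq : A0 * E1 * q ^+ (m.+1 - m') = A0 * E1 * (p * Q').
    have [->|/Fedge_neq0 h] := eqVneq E1 0; first by rewrite mulr0 !mul0r.
    rewrite /A0 /Q' /p; case: leqP => h'; last by rewrite !mul0r.
    by rewrite -exprD; congr (_ * _ ^+ _); lia.
  rewrite /Fcol -/A0 -/C; apply: subr0_eq.
  transitivity (- C * u * R0' * (A0 * E0 * (x 1%N * q ^+ (m - m'))
                                 - A0 * E0 * (z' * p))
    + C * u * R1' * (A0 * E1 * q ^+ (m.+1 - m') - A0 * E1 * (p * Q'))).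
    by rewrite /C; ring.
  by rewrite Ep Eq !subrr !mulr0 addr0.
have HR1 : (1 - u * x 1%N) * r1
         = C * (A1 * (1 - z' * y 0%N * p1) * E0 * R0'
                + A1 * (y 0%N * (p1 * Q') - u) * E1 * R1').
  have [m0|m_gt0] := posnP m.
    by rewrite /r1 m0 mulr0 /A1 m0 ltn0 !mul0r addr0 mulr0.
  rewrite /r1 -(prednK m_gt0) rsum_cons_step ?(prednK m_gt0) //.
  rewrite -/R1' -/R0' -/E0 -/E1 /Fcol -/C.
  have -> : (if (n' <= m.-1)%N then qratio q (k * y 0%N) (m.-1 - n') else 0) = A1.
    rewrite /A1 (_ : (n' <= m.-1)%N = (n' < m)%N); last by lia.
    by case: ltnP => // h; congr qratio; lia.
  have Ep : A1 * E0 * Dcol q u (x 1%N) (y 0%N) m m' m.-1 m'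
            = A1 * E0 * ((1 - z' * y 0%N * p1) / (1 - u * x 1%N)).
    have [->|/Fedge_neq0 h] := eqVneq E0 0; first by rewrite mulr0 !mul0r.
    rewrite /A1 /z' /p1; case: ltnP => h'; last by rewrite !mul0r.
    have -> : Dcol q u (x 1%N) (y 0%N) m m' m.-1 m'
            = Dcol q u (x 1%N) (y 0%N) m.-1.+1 m' m.-1 m' by rewrite prednK.
    rewrite Dcol10; last by lia.
    congr (_ * (_ / _)); rewrite (_ : m.-1 - m' = n' - m' + (m - n').-1)%N; last by lia.
    by rewrite exprD; ring.
  have Eq : A1 * E1 * q ^+ (m - m') = A1 * E1 * (p1 * Q').
    have [->|/Fedge_neq0 h] := eqVneq E1 0; first by rewrite mulr0 !mul0r.
    rewrite /A1 /Q' /p1; case: ltnP => h'; last by rewrite !mul0r.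
    by rewrite -exprD; congr (_ * _ ^+ _); lia.
  rewrite [_ * (A1 * C) * E0](_ : _ = (1 - z' * y 0%N * p1) / (1 - u * x 1%N)
                                   * (A1 * C) * E0); last first.
    apply: subr0_eq; transitivity (C * (A1 * E0 * Dcol q u (x 1%N) (y 0%N) m m' m.-1 m'
            - A1 * E0 * ((1 - z' * y 0%N * p1) / (1 - u * x 1%N)))); first by ring.
    by rewrite Ep subrr mulr0.
  rewrite cancel_common_den //; apply: subr0_eq.
  transitivity (C * R1' * y 0%N * (A1 * E1 * q ^+ (m - m') - A1 * E1 * (p1 * Q'))).
    by ring.
  by rewrite Eq subrr mulr0.
split=> [mn|mn1].
  apply: (exchange_column0 (ux 1%N) HA HE Hl0 Hl1 HR0 HR1).
  rewrite /l lsum_cons // Dcol00 // Dcol01 // /Fcol -/C -/A0 -/E0 -/E1 -/(L' n') -/(L' n'.+1).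
  rewrite cancel_common_den //.
  have Ep : A0 * q ^+ (n - n') = A0 * (q ^+ (n - m) * p).
    rewrite /A0 /p; case: leqP => h; last by rewrite !mul0r.
    by rewrite -exprD; congr (_ * _ ^+ _); lia.
  have -> : (if (n' < m)%N then qratio q (k * y 0%N) (m - n'.+1) else 0) = A1.
    by rewrite /A1 subnS.
  (* Raising [n'] shortens the denominator of [Fcol]; [qratioVS] restores the common factor [C]. *)
  have Eq : A1 * ((1 - q ^+ (n - n')) / qratio q (x 0%N * y 0%N) (n - n'.+1))
            = A1 * ((1 - x 0%N * y 0%N * (q ^+ (n - m) * p1)) * C).
    rewrite /A1 /p1 /C; case: ltnP => h; last by rewrite !mul0r.
    have -> : (n - n' = (n - n'.+1).+1)%N by lia.
    rewrite -qratioVS ?subr_eq0 1?eq_sym // -exprD.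
    by congr (_ * ((_ - _ * _ ^+ _) / _)); lia.
  apply: subr0_eq.
  transitivity (- C * u * x 0%N * E0 * L' n' * (A0 * q ^+ (n - n')
                                     - A0 * (q ^+ (n - m) * p))
    - u * E1 * L' n'.+1
      * (A1 * ((1 - q ^+ (n - n')) / qratio q (x 0%N * y 0%N) (n - n'.+1))
         - A1 * ((1 - x 0%N * y 0%N * (q ^+ (n - m) * p1)) * C))); first by ring.
  by rewrite Ep Eq !subrr !mulr0 subrr.
apply: (exchange_column1 (ux 1%N) HA HE Hl0 Hl1 HR0 HR1).
rewrite /l lsum_cons // Dcol10 // Dcol11 // /Fcol -/C -/A0 -/E0 -/E1 -/(L' n') -/(L' n'.+1).
rewrite cancel_common_den //.
have -> : (if (n' < m)%N then qratio q (k * y 0%N) (m - n'.+1) else 0) = A1.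
  by rewrite /A1 subnS.
have Ep : A0 * q ^+ (n - n').+1 = A0 * (p * q ^+ (n.+1 - m)).
  rewrite /A0 /p; case: leqP => h; last by rewrite !mul0r.
  by rewrite -exprD; congr (_ * _ ^+ _); lia.
have Eq : A1 * q ^+ (n - n') = A1 * (p1 * q ^+ (n.+1 - m)).
  rewrite /A1 /p1; case: ltnP => h; last by rewrite !mul0r.
  by rewrite -exprD; congr (_ * _ ^+ _); lia.
have EC : (1 - x 0%N * y 0%N * q ^+ (n - n')) / qratio q (x 0%N * y 0%N) (n.+1 - n')
          = (1 - q ^+ (n - n').+1) * C.
  by rewrite subSn // qratioVS // subr_eq0 eq_sym.
apply: subr0_eq.
transitivity (A0 * E0 * L' n' * ((1 - x 0%N * y 0%N * q ^+ (n - n'))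
                 / qratio q (x 0%N * y 0%N) (n.+1 - n') - (1 - q ^+ (n - n').+1) * C)
  - C * E0 * L' n' * (A0 * q ^+ (n - n').+1 - A0 * (p * q ^+ (n.+1 - m)))
  + C * E1 * L' n'.+1 * y 0%N * (A1 * q ^+ (n - n') - A1 * (p1 * q ^+ (n.+1 - m)))).
  by ring.
by rewrite Ep Eq EC !subrr !mulr0 subrr addr0.
Qed.
End ExchangeColumns.

(** * The exchange relation for whole rows *)

Definition states (L B : nat) := [seq s <- lists L B | sorted geq s].

Section RowExchange.
Variables (F : fieldType) (q : F).

Lemma Frow_interlace (k : F) (x y : nat -> F) l m c :
  Frow q k x y l m != 0 -> size m = size l ->
  (entry l c.+1 <= entry m c)%N /\ (entry m c <= entry l c)%N.
Proof.
move=> nz sz; have [cl|cl] := ltnP c (size l); last first.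
  by rewrite !nth_default ?sz // (leq_trans cl).
have := nz; rewrite /Frow prodf_seq_neq0 => /allP /(_ (Ordinal cl)).
rewrite mem_index_enum mulf_eq0 negb_or /= => /(_ isT) /andP[].
by move=> /Fedge_neq0 h1 /Fcol_neq0.
Qed.

Lemma Frow_sortedl (k : F) (x y : nat -> F) l m :
  Frow q k x y l m != 0 -> size m = size l -> sorted geq l.
Proof.
move=> nz sz; apply/(sortedP 0%N) => c _.
have [h1 h2] := Frow_interlace c nz sz; exact: leq_trans h1 h2.
Qed.

Lemma Frow_sortedr (k : F) (x y : nat -> F) l m :
  Frow q k x y l m != 0 -> size m = size l -> sorted geq m.
Proof.
move=> nz sz; apply/(sortedP 0%N) => c _.
have [h _] := Frow_interlace c nz sz.
by have [_ h'] := Frow_interlace c.+1 nz sz; exact: leq_trans h' h.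
Qed.

Lemma big_states L B (f : seq nat -> F) :
  (forall s, s \in lists L B -> f s != 0 -> sorted geq s) ->
  \sum_(s <- states L B) f s = \sum_(s <- lists L B) f s.
Proof.
move=> fs; rewrite /states big_filter; apply: big_rmcond_in => s sL.
by have [//|/(fs _ sL) ->] := eqVneq (f s) 0.
Qed.

Hypothesis q_gen : forall i, q ^+ i.+1 != 1.

(** Summing over the first part pairs the column sums with the row vector (E0, - u E1). By
    [Fedge_rec] this is a left eigenvector, with eigenvalue 1 - u k, of the matrix in
    [exchange_columns]. *)
Lemma row_exchange L B (u k : F) (x y : nat -> F) nu mu :
  (forall i, 1 - u * x i != 0) ->
  (forall i j, x i * y i * q ^+ j != 1) ->
  size nu = L.+1 -> size mu = L.+1 -> sorted geq nu -> sorted geq mu ->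
  all (fun a => a < B)%N nu -> all (fun a => a <= B)%N mu -> last 0%N mu = 0%N ->
  \sum_(l <- states L.+1 B) Drow q u x y l nu * Frow q k x y l mu
  = (1 - u * k) / (1 - u * x 0%N)
    * \sum_(r <- states L.+1 B) Frow q k x y nu r * Drow q u (shift x) y mu r.
Proof.
move=> ux xy snu smu.
have szl s : s \in lists L.+1 B -> size s = L.+1.
  by rewrite mem_lists => /andP[/eqP].
rewrite !big_states; first last.
- move=> s /szl ss; rewrite mulf_eq0 negb_or => /andP[_ /Frow_sortedl].
  by apply; rewrite ss smu.
- move=> s /szl ss; rewrite mulf_eq0 negb_or => /andP[/Frow_sortedr + _].
  by apply; rewrite ss snu.
case: nu snu => // n nu [snu]; case: mu smu => // m mu [smu].
move=> ns ms /andP[nB nuB] /andP[mB muB] lm.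
have sz : size mu = size nu by rewrite snu smu.
have [] := exchange_columns q_gen k ux xy sz ns ms nuB muB lm.
set r0 := rsum _ _ _ _ _ _ _ _ _ _ m.
set r1 := (if m is _.+1 then _ else _); set l := lsum _ _ _ _ _ _ _ _ _ _.
move=> H0 H1.
pose E0 := Fedge q k (x 0%N) n m; pose E1 := Fedge q k (x 0%N) n.+1 m.
have -> : \sum_(s <- lists L.+1 B) Drow q u x y s (n :: nu) * Frow q k x y s (m :: mu)
       = E0 * l n - u * E1 * l n.+1.
  rewrite big_lists.
  under eq_bigr => a _.
    rewrite (_ : \sum_(s <- _) _ = (- u) ^+ (a - n) * Fedge q k (x 0%N) a m * l a).
      over.
    rewrite /l /lsum snu mulr_sumr; apply: eq_bigr => s _.
    by rewrite /Drow Frow_cons /=; ring.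
  rewrite (@big_iota_pair _ _ n) // => [|a an an1].
    by rewrite subnn subSnn expr0 expr1 -/E0 -/E1; ring.
  by rewrite /l lsum_out ?mulr0 //; lia.
have -> : \sum_(s <- lists L.+1 B) Frow q k x y (n :: nu) s * Drow q u (shift x) y (m :: mu) s
       = E0 * r0 - u * E1 * r1.
  rewrite big_lists.
  under eq_bigr => b _.
    rewrite (_ : \sum_(s <- _) _ = (- u) ^+ (m - b) * Fedge q k (x 0%N) n b
       * rsum q B u k x y n nu m mu b).
      over.
    rewrite /rsum snu mulr_sumr; apply: eq_bigr => s _.
    by rewrite /Drow Frow_cons /=; ring.
  rewrite (@big_iota_pred _ _ m) // => [|b bm bm1]; last first.
    by rewrite rsum_out ?mulr0 //; lia.
  rewrite subnn expr0 mul1r -/E0 -/r0 /r1 /E1.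
  case: (m) => [|m']; first by rewrite mulr0 subr0 addr0.
  by rewrite subSnn expr1 /Fedge subSS ltnS; ring.
apply: (mulfI (ux 0%N)); rewrite [RHS]mulrA [X in _ = X * _]mulrCA divff // mulr1.
have HE : E0 * (k - x 0%N * q ^+ (n - m)) = E1 * (1 - q ^+ (n.+1 - m)).
  case: (leqP m n.+1) => h; first exact: Fedge_rec.
  by rewrite /E0 /E1 /Fedge leqNgt ltnW // leqNgt h /= !mul0r.
have {H0}H0 : E0 * ((1 - u * x 0%N) * l n)
    = E0 * ((1 - u * (x 0%N * q ^+ (n - m))) * r0
            - u * (k - x 0%N * q ^+ (n - m)) * r1).
  have [->|/Fedge_neq0 h] := eqVneq E0 0; first by rewrite !mul0r.
  by rewrite H0.
have {H1}H1 : E1 * ((1 - u * x 0%N) * l n.+1)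
    = E1 * ((1 - q ^+ (n.+1 - m)) * r0 + (q ^+ (n.+1 - m) - u * k) * r1).
  have [->|/Fedge_neq0 h] := eqVneq E1 0; first by rewrite !mul0r.
  by rewrite H1.
apply: subr0_eq.
transitivity ((E0 * ((1 - u * x 0%N) * l n)
    - E0 * ((1 - u * (x 0%N * q ^+ (n - m))) * r0
            - u * (k - x 0%N * q ^+ (n - m)) * r1))
  - u * (E1 * ((1 - u * x 0%N) * l n.+1)
    - E1 * ((1 - q ^+ (n.+1 - m)) * r0 + (q ^+ (n.+1 - m) - u * k) * r1))
  + u * (r0 - r1) * (E0 * (k - x 0%N * q ^+ (n - m)) - E1 * (1 - q ^+ (n.+1 - m)))).
  by ring.
by rewrite H0 H1 HE !subrr !mulr0 subrr addr0.
Qed.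

End RowExchange.

Lemma mem_states L B s :
  (s \in states L B)
  = [&& size s == L, all (fun a => a <= B)%N s & sorted geq s].
Proof. by rewrite mem_filter mem_lists andbC -andbA. Qed.

Lemma states_uniq L B : uniq (states L B).
Proof. exact/filter_uniq/lists_uniq. Qed.

Lemma states_zero L B : nseq L 0%N \in states L B.
Proof.
rewrite mem_states size_nseq eqxx all_nseq leq0n orbT /=.
by apply/(sortedP 0%N) => i _; rewrite !nth_nseq !if_same.
Qed.

Lemma all_zeroP L s : size s = L -> all (pred1 0%N) s = (s == nseq L 0%N).
Proof.
move=> sL; apply/idP/eqP => [/all_pred1P|] ->; first by rewrite sL.
exact: all_pred1_nseq.
Qed.

Lemma big_states_zero (F : fieldType) L B (f : seq nat -> F) :
  \sum_(s <- states L B) (all (pred1 0%N) s)%:R * f s = f (nseq L 0%N).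
Proof.
rewrite (bigD1_seq _ (states_zero L B) (states_uniq L B)) all_pred1_nseq mul1r /=.
rewrite big1_seq ?addr0 // => s /andP[s0]; rewrite mem_states => /and3P[/eqP sL _ _].
by rewrite (all_zeroP sL) (negPf s0) mul0r.
Qed.

(** * Sums over chains of partitions *)

Section ChainSums.
Variables (F : fieldType) (q : F).

(** The matrix element between [l] and the empty partition of the product of the row operators, with
    intermediate states in [St]. *)
Fixpoint chain_sum (St : seq (seq nat)) (rows : seq (seq nat -> seq nat -> F))
    (l : seq nat) : F :=
  if rows is R :: rows' then \sum_(m <- St) R l m * chain_sum St rows' m
  else (all (pred1 0%N) l)%:R.

Fixpoint Frows (x y : nat -> F) (ks : seq F) : seq (seq nat -> seq nat -> F) :=
  if ks is k :: ks' then Frow q k x y :: Frows (shift x) y ks' else [::].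

Definition Drows (x y : nat -> F) (us : seq F) : seq (seq nat -> seq nat -> F) :=
  [seq Drow q u x y | u <- us].

Variables (L B : nat).
Local Notation St := (states L.+1 B).

Lemma size_state s : s \in St -> size s = L.+1.
Proof. by rewrite mem_states => /and3P[/eqP]. Qed.

Lemma sum_neq0 (I : eqType) (r : seq I) (f : I -> F) :
  \sum_(i <- r) f i != 0 -> exists2 i, i \in r & f i != 0.
Proof.
move=> nz; have [/hasP[i ir fi]|/hasPn h] := boolP (has (fun i => f i != 0) r).
  by exists i.
case/eqP: nz; apply: big1_seq => i /= /h; by rewrite negbK => /eqP.
Qed.

(** By interlacing, [l] has at most one more nonzero part than the next state, and the last state is
    empty. *)
Lemma Frows_support x y ks l c : l \in St -> chain_sum St (Frows x y ks) l != 0 ->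
  (size ks <= c)%N -> entry l c = 0%N.
Proof.
elim: ks x l c => [|k ks IH] x l c lS /=.
  case: allP => [l0 _ _|]; last by rewrite eqxx.
  have [cl|cl] := ltnP c (size l); last by rewrite nth_default.
  exact/eqP/l0/mem_nth.
case/sum_neq0 => m mS; rewrite mulf_eq0 negb_or => /andP[Flm mn0].
case: c => // c cs; have sz : size m = size l by rewrite !size_state.
have [h _] := Frow_interlace c Flm sz.
by move: h; rewrite (IH _ _ _ mS mn0 cs) leqn0 => /eqP.
Qed.

(** The left label of the first vertex is at most one, so each row lowers the first part by at most
    one. *)
Lemma Drows_support x y us l : l \in St -> chain_sum St (Drows x y us) l != 0 ->
  (entry l 0 <= size us)%N.
Proof.
elim: us l => [|u us IH] l lS /=.
  case: allP => [l0 _|]; last by rewrite eqxx.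
  by rewrite leqn0; apply/l0/mem_nth; rewrite size_state.
case/sum_neq0 => m mS; rewrite mulf_eq0 negb_or => /andP[Dlm mn0].
have := IH m mS mn0; move: Dlm; rewrite mulf_eq0 negb_or => /andP[_].
have sl := size_state lS.
rewrite /Dprod prodf_seq_neq0 => /allP; rewrite sl => /(_ ord0).
rewrite mem_index_enum => /(_ isT) /= Dnz.
have := @Dcol_left F q u (x 0%N) (y 0%N) (entry l 0) (entry l 1) (entry m 0) (entry m 1).
case: (ltnP 1 (entry l 0 - entry m 0)) => h; last by lia.
by move=> /(_ isT) E; rewrite E eqxx in Dnz.
Qed.

Lemma Drow_zero u x y m : (forall i, 1 - u * x i != 0) -> m \in St ->
  Drow q u x y (nseq L.+1 0%N) m = (all (pred1 0%N) m)%:R.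
Proof.
move=> ux mS; rewrite (all_zeroP (size_state mS)) /Drow /Dprod size_nseq.
rewrite (nth_nseq _ _ 0) /= sub0n mul1r; case: eqP => [->|/eqP mn0].
  apply: big1 => c _; rewrite -[0%N :: _]/(nseq L.+1 0%N) !nth_nseq !if_same.
  by rewrite Dcol00 // expr0 mulr1 divff.
move: mn0; rewrite -(all_zeroP (size_state mS)) => /allPn[a am a0].
have := am; rewrite -index_mem (size_state mS) => il.
rewrite (bigD1 (Ordinal il)) //= [Dcol _ _ _ _ _ _ _ _]ifF ?mul0r //.
rewrite nth_index // -[0%N :: _]/(nseq L.+1 0%N) nth_nseq if_same leqn0.
by apply/negbTE.
Qed.

Lemma Frow_zero k x y m : m \in St ->
  Frow q k x y (nseq L.+1 0%N) m = (all (pred1 0%N) m)%:R.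
Proof.
move=> mS; rewrite (all_zeroP (size_state mS)) /Frow size_nseq.
case: eqP => [->|/eqP mn0].
  apply: big1 => c _; rewrite !nth_nseq !if_same.
  by rewrite /Fedge /Fcol !subnn !qratio0 // big_ord0 divr1 mulr1.
move: mn0; rewrite -(all_zeroP (size_state mS)) => /allPn[a am a0].
have := am; rewrite -index_mem (size_state mS) => il.
rewrite (bigD1 (Ordinal il)) //= [Fedge _ _ _ _ _]ifF ?mul0r //.
rewrite nth_index // -[0%N :: _]/(nseq L.+1 0%N) nth_nseq if_same leqn0.
by apply/negbTE.
Qed.

Lemma Frows_zero x y ks : chain_sum St (Frows x y ks) (nseq L.+1 0%N) = 1.
Proof.
elim: ks x => [|k ks IH] x; first by rewrite /= all_pred1_nseq.
rewrite /= -[RHS](IH (shift x)) -(@big_states_zero _ _ B).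
by apply: eq_big_seq => m mS; rewrite Frow_zero.
Qed.

Hypothesis q_gen : forall i, q ^+ i.+1 != 1.

(** Induction on the rows of F: [row_exchange] takes D past the first of them. Past the last one, D
    starts at the empty partition, where [Drow_zero] removes it with weight one. *)
Lemma Drow_Frows (u : F) (x y : nat -> F) ks nu :
  (forall i, 1 - u * x i != 0) ->
  (forall r i j, x (i + r)%N * y i * q ^+ j != 1) ->
  nu \in St -> all (fun a => a < B)%N nu -> (size ks <= L.+1)%N ->
  \sum_(l <- St) Drow q u x y l nu * chain_sum St (Frows x y ks) l
  = \prod_(i < size ks) ((1 - u * nth 0 ks i) / (1 - u * x i))
    * chain_sum St (Frows x y ks) nu.
Proof.
elim: ks x nu => [|k ks IH] x nu ux xy nuS nuB sks.
  rewrite big_ord0 mul1r [RHS]/= -(Drow_zero y ux nuS).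
  rewrite -(@big_states_zero _ _ B (fun l => Drow q u x y l nu)).
  by apply: eq_bigr => l _; apply: mulrC.
have xy0 i j : x i * y i * q ^+ j != 1 by rewrite -[in x i](addn0 i).
have xyS r i j : shift x (i + r)%N * y i * q ^+ j != 1 by rewrite /shift -addnS.
have snu := nuS; rewrite mem_states in snu; case/and3P: snu => /eqP snu _ onu.
rewrite big_ord_recl /=; pose G := chain_sum St (Frows (shift x) y ks).
transitivity (\sum_(m <- St) (\sum_(l <- St) Drow q u x y l nu * Frow q k x y l m) * G m).
  under eq_bigr => l _ do rewrite mulr_sumr.
  rewrite exchange_big; apply: eq_bigr => m _; rewrite mulr_suml.
  by apply: eq_bigr => l _; rewrite mulrA.
transitivity (\sum_(m <- St) (1 - u * k) / (1 - u * x 0%N)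
    * \sum_(r <- St) Frow q k x y nu r * Drow q u (shift x) y m r * G m).
  apply: eq_big_seq => m mS.
  have [-> |mn0] := eqVneq (G m) 0.
    by rewrite mulr0 big1 ?mulr0 // => r _; rewrite mulr0.
  have := mS; rewrite mem_states => /and3P[/eqP sm Bm om].
  rewrite (row_exchange q_gen k ux xy0 snu sm onu om nuB Bm) -?mulrA ?mulr_suml //.
  (* At most [L] rows of F remain below [m], so the last of its [L.+1] entries is zero, as
     [row_exchange] demands. *)
  by rewrite -nth_last sm; apply: (Frows_support mS mn0); rewrite -ltnS.
rewrite -mulr_sumr exchange_big -[RHS]mulrA; congr (_ * _); rewrite mulr_sumr.
apply: eq_big_seq => r rS; have [-> |Fnz] := eqVneq (Frow q k x y nu r) 0.
  by rewrite mul0r mulr0 big1 // => m _; rewrite !mul0r.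
under eq_bigr => m _ do rewrite -mulrA.
rewrite -mulr_sumr IH // => [|i||]; [by rewrite mulrCA| exact: ux| |exact: ltnW].
(* Interlacing bounds [r] by [nu], so the strict bound by [B] passes to the induction hypothesis. *)
apply/(all_nthP 0%N) => i ir; rewrite (size_state rS) in ir.
have [_ h] := Frow_interlace i Fnz (etrans (size_state rS) (esym snu)).
by apply: leq_ltn_trans h _; apply: (all_nthP 0%N nuB); rewrite snu.
Qed.

Lemma Drows_Frows (x y : nat -> F) us ks :
  (forall u i, u \in us -> 1 - u * x i != 0) ->
  (forall r i j, x (i + r)%N * y i * q ^+ j != 1) ->
  (size us <= B)%N -> (size ks <= L.+1)%N ->
  \sum_(l <- St) chain_sum St (Drows x y us) l * chain_sum St (Frows x y ks) l
  = \prod_(u <- us) \prod_(i < size ks) ((1 - u * nth 0 ks i) / (1 - u * x i)).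
Proof.
move=> + xy + sks; elim: us => [|u us IH] ux sus.
  by rewrite big_nil /= big_states_zero Frows_zero.
rewrite big_cons -IH ?(ltnW sus) //; last first.
  by move=> v i vus; apply: ux; rewrite inE vus orbT.
pose G := chain_sum St (Frows x y ks); rewrite mulr_sumr.
transitivity (\sum_(nu <- St) chain_sum St (Drows x y us) nu
     * \sum_(l <- St) Drow q u x y l nu * G l).
  under eq_bigr => l _ do rewrite mulr_suml.
  rewrite exchange_big; apply: eq_bigr => nu _; rewrite mulr_sumr.
  by apply: eq_bigr => l _; rewrite mulrAC mulrC mulrA.
apply: eq_big_seq => nu nuS.
have [-> |mn0] := eqVneq (chain_sum St (Drows x y us) nu) 0.
  by rewrite !mul0r mulr0.
rewrite Drow_Frows 1?mulrCA // => [i|]; first by apply: ux; rewrite inE eqxx.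
(* The remaining D-rows bound the first part of [nu] by their number, which is less than [B]: there
   is room for one more raise. *)
have := nuS; rewrite mem_states => /and3P[_ _ onu].
apply/(all_nthP 0%N) => i il; apply: leq_ltn_trans sus.
apply: leq_trans (Drows_support nuS mn0).
have geq_trans : transitive geq by move=> a b c ba ac; exact: leq_trans ac ba.
by apply: (sorted_leq_nth geq_trans leqnn 0%N onu) => //; exact: leq_ltn_trans il.
Qed.

End ChainSums.

(** * Lattice sums as sums over chains *)

(** Reindexes a finitely supported sum by a list; [phi] has to reach only the support of [f]. It
    serves both for lattice configurations and for partitions. *)
Lemma fsbig_image (F : fieldType) (T : choiceType) (I : eqType) (A : set T)
    (f : T -> F) (s : seq I) (P : pred I) (phi : I -> T) :
  uniq s -> (forall i, i \in s -> P i -> A (phi i)) ->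
  {in [pred i | (i \in s) && P i] &, injective phi} ->
  (forall t, A t -> f t != 0 -> exists i, [/\ i \in s, P i & phi i = t]) ->
  \sum_(t \in A) f t = \sum_(i <- s | P i) f (phi i).
Proof.
move=> us sA phi_inj Af.
transitivity (\sum_(t <- [seq phi i | i <- s & P i]) f t); last first.
  by rewrite big_map big_filter.
rewrite [RHS]fsbig_seq; last first.
  rewrite map_inj_in_uniq ?filter_uniq // => i j.
  by rewrite !mem_filter ![P _ && _]andbC; exact: phi_inj.
apply/esym/fsbig_widen => [t /= /mapP[i]|t [At /= tN]].
  by rewrite mem_filter => /andP[Pi si] ->; exact: sA.
apply/eqP; apply: contra_notT tN => /(Af t At)[i [si Pi <-]].
by rewrite map_f // mem_filter Pi.
Qed.

Lemma prod_ord_pad (F : fieldType) (f : nat -> F) a b : (a <= b)%N ->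
  (forall i, (a <= i)%N -> f i = 1) -> \prod_(i < a) f i = \prod_(i < b) f i.
Proof.
move=> ab f1; rewrite -!(big_mkord xpredT f) [RHS](@big_cat_nat _ _ _ a) //=.
rewrite [X in _ * X]big1_seq ?mulr1 // => i.
by rewrite mem_index_iota => /andP[_ /andP[ai _]]; exact: f1.
Qed.

Lemma nth_map_enum_ord n T (x0 : T) (f : 'I_n -> T) (r : 'I_n) :
  nth x0 [seq f i | i <- enum 'I_n] r = f r.
Proof. by rewrite (nth_map r) ?size_enum_ord // nth_ord_enum. Qed.

Fixpoint chains (T : eqType) n (St : seq T) : seq (seq T) :=
  if n is n'.+1 then [seq m :: c | m <- St, c <- chains n' St] else [:: [::]].

Lemma mem_chains (T : eqType) n (St : seq T) c :
  (c \in chains n St) = (size c == n) && all (mem St) c.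
Proof.
elim: n c => [|n IH] c; first by case: c.
apply/allpairsP/idP => [[[a l] [aS + ->]]|].
  by rewrite IH /= eqSS => /andP[sl lS]; apply/and3P.
case: c => // a l; rewrite [size _]/= eqSS => /andP[sl /andP[aS lS]].
by exists (a, l); rewrite IH sl.
Qed.

Lemma chains_uniq (T : eqType) n (St : seq T) : uniq St -> uniq (chains n St).
Proof.
move=> uS; elim: n => //= n IH; apply: allpairs_uniq => //.
by move=> [a l] [b m] _ _ /= [-> ->].
Qed.

Definition incl (l m : seq nat) :=
  all (fun i => (entry m i <= entry l i)%N) (iota 0 (size l)).

Lemma inclP l m : size m = size l ->
  reflect (forall i, (entry m i <= entry l i)%N) (incl l m).
Proof.
move=> sz; apply: (iffP allP) => [h i|h i _]; last exact: h.
have [il|il] := ltnP i (size l); last by rewrite nth_default ?sz.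
by apply: h; rewrite mem_iota.
Qed.

(* A nonzero lattice configuration with empty bottom boundary is the same as a
   chain of partitions lambda = p_0, p_1, ..., p_n = 0: the vertical labels are
   p_r(c) - p_r(c+1) and the horizontal ones p_r(c) - p_(r+1)(c). *)
Section LatticeToChains.
Variables (F : fieldType).

Definition row_product (w : nat -> nat -> nat -> nat -> nat -> F) L
    (l m : seq nat) : F :=
  \prod_(j < L) w j (entry m j - entry m j.+1)%N (entry l j - entry m j)%N
                    (entry l j - entry l j.+1)%N (entry l j.+1 - entry m j.+1)%N.

(** [incl] discards pairs whose negative horizontal labels truncated subtraction would turn into
    0. *)
Definition row_weight (g : nat -> F) (w : nat -> nat -> nat -> nat -> nat -> F)
    (l m : seq nat) : F :=
  if incl l m then g (entry l 0 - entry m 0)%N * row_product w (size l) l m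
  else 0.

Lemma chain_sumE (St : seq (seq nat)) (rows : seq (seq nat -> seq nat -> F)) l :
  chain_sum St rows l
  = \sum_(c <- chains (size rows) St)
      (\prod_(r < size rows)
          nth (fun _ _ => 0) rows r (nth [::] (l :: c) r) (nth [::] c r))
      * (all (pred1 0%N) (last l c))%:R.
Proof.
elim: rows l => [|R rows IH] l; first by rewrite /= big_seq1 big_ord0 mul1r.
rewrite [size _]/= big_allpairs_dep /=; apply: eq_bigr => m _.
rewrite IH mulr_sumr; apply: eq_bigr => c _.
by rewrite big_ord_recl /= -mulrA.
Qed.

Variables (n L K B : nat) (lambda : intpart).
Hypotheses (sL : (size lambda <= L)%N) (LK : (L <= K)%N)
  (lamB : (part lambda 0 <= B)%N).
Local Notation St := (states K.+1 B).

Definition state_of (M : nat) (la : intpart) := mkseq (part la) M.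

Lemma entry_state_of (la : intpart) M i :
  (size la <= M)%N -> entry (state_of M la) i = part la i.
Proof.
move=> sM; have [iM|Mi] := ltnP i M; first by rewrite nth_mkseq.
by rewrite nth_default ?size_mkseq // /part nth_default // (leq_trans sM).
Qed.

Lemma part_sorted (la : intpart) i : (part la i.+1 <= part la i)%N.
Proof.
have [iM|Mi] := ltnP i.+1 (size la); last by rewrite /part nth_default.
have /andP[/(sortedP 0%N) h _] := valP la; exact: h.
Qed.

Lemma part_le0 (la : intpart) i : (part la i <= part la 0)%N.
Proof. by elim: i => // i; apply: leq_trans (part_sorted _ _). Qed.

Lemma sum_mconj (la : intpart) M j : (size la <= M)%N ->
  (\sum_(j <= i < M) mconj la i)%N = part la j.
Proof.
move=> sM; have [jM|Mj] := leqP j M; last first.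
  by rewrite big_geq ?(ltnW Mj) // /part nth_default // (leq_trans sM) // ltnW.
rewrite -(subKn jM); elim: (M - j)%N (leq_subr j M) => [|d IH] dM.
  by rewrite subn0 big_geq // /part nth_default.
rewrite big_ltn; last by lia.
rewrite (_ : (M - d.+1).+1 = M - d)%N; last by lia.
rewrite IH ?(ltnW dM) // /mconj (_ : (M - d.+1).+1 = M - d)%N; last by lia.
have := part_sorted la (M - d.+1); rewrite (_ : (M - d.+1).+1 = M - d)%N; lia.
Qed.

Lemma state_of_states : state_of K.+1 lambda \in St.
Proof.
have sK : (size lambda <= K.+1)%N by rewrite (leq_trans sL) // ltnW.
rewrite mem_states; apply/and3P; split; first by rewrite size_mkseq.
  apply/(all_nthP 0%N) => i _; rewrite entry_state_of //.
  exact: leq_trans (part_le0 _ _) lamB.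
apply/(sortedP 0%N) => i _; rewrite !entry_state_of //; exact: part_sorted.
Qed.

Local Notation lam := (state_of K.+1 lambda).

Definition chain_ok (c : seq (seq nat)) :=
  [forall r : 'I_n, incl (nth [::] (lam :: c) r) (nth [::] c r)]
  && all (pred1 0%N) (last lam c).

Definition chain_label (c : seq (seq nat)) (r : nat) :=
  (entry (nth [::] (lam :: c) r) 0 - entry (nth [::] c r) 0)%N.

Local Notation chain_entry c r i := (entry (nth [::] (lam :: c) r) i).

Lemma chain_entry0 c i : chain_entry c 0%N i = part lambda i.
Proof. by rewrite entry_state_of // (leq_trans sL) // ltnW. Qed.

Lemma chain_state c r : c \in chains n St -> (r <= n)%N ->
  nth [::] (lam :: c) r \in St.
Proof.
rewrite mem_chains => /andP[/eqP sc /allP cS] rn.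
apply: (allP (_ : all (mem St) (lam :: c))); last by apply: mem_nth; rewrite /= sc.
by rewrite /= state_of_states; apply/allP.
Qed.

Lemma chain_ok_incl c r i : c \in chains n St -> chain_ok c -> (r < n)%N ->
  (chain_entry c r.+1 i <= chain_entry c r i)%N.
Proof.
move=> cS /andP[/forallP h _] rn; have /= := h (Ordinal rn).
have sz : size (nth [::] c r) = size (nth [::] (lam :: c) r).
  by rewrite (size_state (chain_state cS (ltnW rn))) (size_state (chain_state cS rn)).
by move/(inclP sz)/(_ i).
Qed.

Lemma chain_ok_last c i : c \in chains n St -> chain_ok c ->
  chain_entry c n i = 0%N.
Proof.
rewrite mem_chains => /andP[/eqP sc _] /andP[_ z].
rewrite -[in nth _ _ n]sc nth_last /=.
move: z; have [il|il] := ltnP i (size (last lam c)); last by rewrite nth_default.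
by move/allP => /(_ _ (mem_nth 0%N il)) /eqP.
Qed.

Lemma chain_ok_out c r i : c \in chains n St -> chain_ok c -> (r <= n)%N ->
  (L < i)%N -> chain_entry c r i = 0%N.
Proof.
move=> cS ok + Li; elim: r => [_|r IH rn].
  by rewrite chain_entry0 /part nth_default // (leq_trans sL) // ltnW.
by have := chain_ok_incl i cS ok rn; rewrite (IH (ltnW rn)) leqn0 => /eqP.
Qed.

Variable wt : 'I_n -> nat -> nat -> nat -> nat -> nat -> F.
Hypothesis wt_cons :
  forall r c i j k l, (i + j)%N != (k + l)%N -> wt r c i j k l = 0.

Lemma lattice_sum_chains (a : 'I_n -> nat) :
  @lattice_sum F n L.+1 wt a lambda empty_part
  = \sum_(c <- chains n St
            | chain_ok c && [forall r : 'I_n, a r == chain_label c r])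
      \prod_(r < n) row_product (wt r) L.+1 (nth [::] (lam :: c) r)
                                            (nth [::] c r).
Proof.
pose P c r i := chain_entry c r i.
have P0 c i : P c 0%N i = part lambda i := chain_entry0 c i.
have PS c : c \in chains n St -> forall r, (r <= n)%N -> nth [::] (lam :: c) r \in St.
  by move=> cS r; exact: chain_state.
have Pincl c : c \in chains n St -> chain_ok c -> forall r i, (r < n)%N ->
    (P c r.+1 i <= P c r i)%N.
  by move=> cS ok r i; exact: chain_ok_incl.
have Plast c : c \in chains n St -> chain_ok c -> forall i, P c n i = 0%N.
  by move=> cS ok i; exact: chain_ok_last.
have PL c : c \in chains n St -> chain_ok c -> forall r i, (r <= n)%N -> (L < i)%N ->
    P c r i = 0%N.
  by move=> cS ok r i; exact: chain_ok_out.
pose phi c : 'M[nat]_(n.+1, L.+1) * 'M[nat]_(n, L.+2) :=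
  (\matrix_(r, j) (P c r j - P c r j.+1)%N, \matrix_(r, j) (P c r j - P c r.+1 j)%N).
have -> : \sum_(c <- chains n St
            | chain_ok c && [forall r : 'I_n, a r == chain_label c r])
      \prod_(r < n) row_product (wt r) L.+1 (nth [::] (lam :: c) r) (nth [::] c r)
  = \sum_(c <- chains n St
            | chain_ok c && [forall r : 'I_n, a r == chain_label c r])
      lattice_weight wt (phi c).
  apply: eq_bigr => c _; apply: eq_bigr => r _; apply: eq_bigr => j _.
  by rewrite !mxE.
apply: fsbig_image.
- exact/chains_uniq/states_uniq.
- move=> c cS /andP[ok /forallP ac]; split=> [j|j|r|r]; rewrite mxE.
  + by rewrite !P0.
  + by rewrite !(Plast c cS ok) /mconj /part /= !nth_nil.
  + by rewrite (eqP (ac r)).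
  + by rewrite (PL c cS ok) //; exact: ltnW.
- move=> c c' /andP[cS /andP[ok _]] /andP[c'S /andP[ok' _]] [_ /matrixP eh].
  (* The horizontal labels alone suffice: from the common top row [lambda] they determine each next
     row. *)
  have PP r i : (r <= n)%N -> P c r i = P c' r i.
    elim: r => [|r IH] rn; first by rewrite !P0.
    have [Li|iL] := ltnP L i; first by rewrite !PL.
    have := eh (Ordinal rn) (inord i); rewrite !mxE /= inordK ?ltnS ?leqW //.
    have := Pincl c cS ok r i rn; have := Pincl c' c'S ok' r i rn.
    have := IH (ltnW rn); lia.
  have sc : size c = n by move: cS; rewrite mem_chains => /andP[/eqP].
  have sc' : size c' = n by move: c'S; rewrite mem_chains => /andP[/eqP].
  apply: (@eq_from_nth _ [::]); rewrite ?sc ?sc' // => r rn.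
  apply: (@eq_from_nth _ 0%N) => [|i _]; last exact: (PP r.+1).
  by rewrite (size_state (PS c cS r.+1 rn)) (size_state (PS c' c'S r.+1 rn)).
move=> [v h] [/= v0 vn h0 hL]; rewrite /lattice_weight prodf_seq_neq0 => /allP nz.
pose V r i : nat := v (inord r) (inord i); pose H (r : 'I_n) i : nat := h r (inord i).
(* The inverse of [phi]: parts are tail sums of vertical labels. *)
pose T r j := (\sum_(j <= i < L.+1) V r i)%N.
have VH (r : 'I_n) j : (j < L.+1)%N -> (V r.+1 j + H r j = V r j + H r j.+1)%N.
  move=> jL; have := nz r (mem_index_enum _); rewrite /= prodf_seq_neq0.
  move=> /allP /(_ (Ordinal jL) (mem_index_enum _)) /= nzrj.
  have : (v (lift ord0 r) (Ordinal jL) + h r (widen_ord (leqnSn L.+1) (Ordinal jL))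
    = v (widen_ord (leqnSn n) r) (Ordinal jL) + h r (lift ord0 (Ordinal jL)))%N.
    by apply/eqP; apply: contraNT nzrj => /wt_cons ->.
  rewrite /V /H; congr (_ + _ = _ + _)%N; congr (fun_of_matrix _ _ _);
    by apply/val_inj; rewrite /= ?inordK // ?ltnS // ltnW // ltnS.
have Tout r j : (L < j)%N -> T r j = 0%N by move=> Lj; rewrite /T big_geq.
have T0 j : T 0%N j = part lambda j.
  rewrite -(@sum_mconj _ L.+1) ?(leqW sL) // /T !big_nat.
  apply: eq_bigr => i /andP[_ iL]; rewrite /V (_ : inord 0 = ord0) ?v0 ?inordK //.
  by apply/val_inj; rewrite /= inordK.
have Tn j : T n j = 0%N.
  rewrite /T big1 // => i _; rewrite /V (_ : inord n = ord_max) ?vn.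
    by rewrite /mconj /part /= !nth_nil.
  by apply/val_inj; rewrite /= inordK.
(* Conservation at the vertices, summed from the right boundary, where the horizontal label is
   zero. *)
have HT (r : 'I_n) j : (j <= L.+1)%N -> (H r j + T r.+1 j = T r j)%N.
  move=> jL; rewrite -(subKn jL); elim: (L.+1 - j)%N (leq_subr j L.+1) => [|d IH] dL.
    rewrite subn0 !Tout // addn0 /H -(hL r); congr (h r _).
    by apply/val_inj; rewrite /= inordK.
  have kL : (L.+1 - d.+1 < L.+1)%N by lia.
  have kS : ((L.+1 - d.+1).+1 = L.+1 - d)%N by lia.
  have E r' : (T r' (L.+1 - d.+1) = V r' (L.+1 - d.+1) + T r' (L.+1 - d))%N.
    by rewrite /T big_ltn // kS.
  by have := IH (ltnW dL); have := VH r _ kL; rewrite !E kS; lia.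
have Tle (r : 'I_n) j : (T r.+1 j <= T r j)%N.
  by have [jL|Lj] := leqP j L.+1; [rewrite -(HT r j jL) leq_addl | rewrite Tout // ltnW].
have Tpart r j : (r <= n)%N -> (T r j <= part lambda j)%N.
  elim: r => [_|r IH rn]; first by rewrite T0.
  by apply: leq_trans (IH (ltnW rn)); exact: (Tle (Ordinal rn)).
have Tsorted r j : (T r j.+1 <= T r j)%N.
  have [jL|Lj] := ltnP j L.+1; last by rewrite (Tout _ _ (leqW Lj)).
  by rewrite /T [leqRHS]big_ltn // leq_addl.
pose st r := mkseq (T r) K.+1; pose c := mkseq (fun r => st r.+1) n.
have entry_st r j : entry (st r) j = T r j.
  have [jK|Kj] := ltnP j K.+1; first by rewrite nth_mkseq.
  by rewrite nth_default ?size_mkseq // Tout // (leq_trans _ Kj).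
have Pc r j : (r <= n)%N -> P c r j = T r j.
  by case: r => [|r] rn; [rewrite P0 T0 | rewrite /P /= nth_mkseq // entry_st].
have cS : c \in chains n St.
  rewrite mem_chains size_mkseq eqxx; apply/(all_nthP [::]) => r.
  rewrite size_mkseq => rn; rewrite nth_mkseq //.
  rewrite /= mem_states; apply/and3P; split; first by rewrite size_mkseq.
    apply/(all_nthP 0%N) => i _; rewrite entry_st.
    by apply: leq_trans (Tpart _ _ rn) _; exact: leq_trans (part_le0 _ _) lamB.
  by apply/(sortedP 0%N) => i _; rewrite !entry_st; exact: Tsorted.
have sc : size c = n by rewrite size_mkseq.
have nthS (r : 'I_n) : size (nth [::] c r) = size (nth [::] (lam :: c) r).
  by rewrite (size_state (PS c cS r _)) 1?ltnW // (size_state (PS c cS r.+1 _)).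
exists c; split=> //.
  apply/andP; split; [apply/andP; split|].
  - apply/forallP => r; apply/(inclP (nthS r)) => i.
    by rewrite -[leqLHS]/(P c r.+1 i) -[leqRHS]/(P c r i) !Pc // ltnW.
  - apply/(all_nthP 0%N) => i _; rewrite /= (_ : last lam c = nth [::] (lam :: c) n).
      by rewrite -[entry _ _]/(P c n i) Pc // Tn.
    by rewrite -[X in nth _ _ X]sc nth_last.
  apply/forallP => r; rewrite /chain_label -[entry (nth _ (_ :: _) _) _]/(P c r 0%N).
  rewrite -[entry _ _]/(P c r.+1 0%N) (Pc _ _ (ltn_ord r)) (Pc _ _ (ltnW (ltn_ord r))) -HT // addnK -h0 /H.
  by apply/eqP; congr (h r _); apply/val_inj; rewrite /= inordK.
congr (_, _); apply/matrixP => r j; rewrite mxE.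
  by rewrite !(Pc _ _ (ltn_ord r : (r <= n)%N)) /T big_ltn // addnK /V !inord_val.
rewrite (Pc _ _ (ltn_ord r)) (Pc _ _ (ltnW (ltn_ord r))).
by rewrite -(HT r j (ltn_ord j)) addnK /H inord_val.
Qed.

(** The lattice width depends on [lambda], whereas the final sum needs one width for all partitions;
    the added columns carry only zero labels. *)
Lemma row_product_pad (w : nat -> nat -> nat -> nat -> nat -> F) l m :
  (forall j, w j 0%N 0%N 0%N 0%N = 1) ->
  (forall j, (L < j)%N -> entry l j = 0%N) ->
  (forall j, (L < j)%N -> entry m j = 0%N) ->
  row_product w K.+1 l m = row_product w L.+1 l m.
Proof.
move=> w1 l0 m0; apply/esym.
apply: (@prod_ord_pad _ (fun j => w j (entry m j - entry m j.+1)%N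
  (entry l j - entry m j)%N (entry l j - entry l j.+1)%N
  (entry l j.+1 - entry m j.+1)%N)) => // j Lj.
by rewrite !l0 ?m0 // leqW.
Qed.

Variables (g : 'I_n -> nat -> F) (A : finType) (lab : A -> nat).
Variable (Q : pred {ffun 'I_n -> A}).
Hypotheses (wt_pad : forall r c, wt r c 0%N 0%N 0%N 0%N = 1)
  (lab_inj : injective lab)
  (Q_label : forall c, c \in chains n St -> chain_ok c ->
     (forall r : 'I_n, row_product (wt r) L.+1 (nth [::] (lam :: c) r)
                                            (nth [::] c r) != 0) ->
     exists2 a : {ffun 'I_n -> A}, Q a & forall r, lab (a r) = chain_label c r).

(** A chain determines its left labels, so after exchanging the sums exactly one [a] survives for
    each chain. [Q_label] concerns only chains of nonzero weight, which allows [A] to be as small as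
    [bool]. *)
Lemma lattice_sum_chain_sum :
  \sum_(a : {ffun 'I_n -> A} | Q a)
     (\prod_(r < n) g r (lab (a r)))
     * @lattice_sum F n L.+1 wt (fun r => lab (a r)) lambda empty_part
  = chain_sum St [seq row_weight (g r) (wt r) | r <- enum 'I_n] lam.
Proof.
pose W c := \prod_(r < n) row_product (wt r) L.+1 (nth [::] (lam :: c) r)
                                                  (nth [::] c r).
transitivity (\sum_(c <- chains n St | chain_ok c)
                 (\prod_(r < n) g r (chain_label c r)) * W c).
  under eq_bigr => a _ do rewrite lattice_sum_chains mulr_sumr big_mkcondr.
  rewrite exchange_big /= [LHS]big_seq_cond [RHS]big_seq_cond.
  apply: eq_bigr => c /andP[cS ok].
  have [W0|Wn0] := eqVneq (W c) 0.
    by rewrite W0 mulr0 big1 // => a _; rewrite -/(W c) W0 mulr0 if_same.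
  have [|a Qa la] := Q_label cS ok.
    by move=> r; move: Wn0; rewrite /W prodf_seq_neq0 => /allP/(_ r (mem_index_enum _)).
  rewrite (bigD1 a) //= ifT; last by apply/forallP => r; rewrite la.
  rewrite [X in _ + X]big1 ?addr0 => [|b /andP[_ ba]].
    by congr (_ * _); apply: eq_bigr => r _; rewrite la.
  rewrite ifN //; apply: contra ba => /forallP h; apply/eqP/ffunP => r.
  by apply: lab_inj; rewrite la (eqP (h r)).
have sr : size [seq row_weight (g r) (wt r) | r <- enum 'I_n] = n.
  by rewrite size_map size_enum_ord.
rewrite chain_sumE sr big_mkcond; apply: eq_big_seq => c cS.
rewrite /chain_ok; case lc0: (all _ (last lam c));
  rewrite ?andbF ?andbT ?mulr0 ?mulr1 //.
under [RHS]eq_bigr do rewrite nth_map_enum_ord.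
case: ifP => [ok|/negbT]; last first.
  rewrite negb_forall => /existsP[r nr].
  by rewrite (bigD1 r) //= /row_weight (negPf nr) mul0r.
have okc : chain_ok c by rewrite /chain_ok ok lc0.
rewrite /W -big_split; apply: eq_bigr => r _ /=.
rewrite /row_weight (forallP ok r) (size_state (chain_state cS (ltnW (ltn_ord r)))).
congr (_ * _); apply/esym/row_product_pad => // j Lj.
  by apply: (chain_ok_out cS okc _ Lj); exact: ltnW.
exact: (@chain_ok_out c r.+1 j cS okc (ltn_ord r) Lj).
Qed.
End LatticeToChains.

(** * Gauge factors *)

Section Gauge.
Variables (F : fieldType) (q : F).

(** The factors telescope along the chain, and at its empty end the gauge is 1. The gauge may vary
    with the row because the parameters of F are shifted from row to row. *)
Lemma chain_sum_gauge (St : seq (seq nat)) (al : nat -> seq nat -> F) rows rows' :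
  size rows = size rows' ->
  (forall r l m, (r < size rows)%N -> l \in St -> m \in St ->
     nth (fun _ _ => 0) rows r l m
     = al r l / al r.+1 m * nth (fun _ _ => 0) rows' r l m) ->
  (forall r l, l \in St -> al r l != 0) ->
  (forall r l, l \in St -> all (pred1 0%N) l -> al r l = 1) ->
  forall l, l \in St -> chain_sum St rows l = al 0%N l * chain_sum St rows' l.
Proof.
elim: rows rows' al => [|R rows IH] [|R' rows'] al //= sr Rr al0 al1 l lS.
  by case: (boolP (all _ l)) => h; rewrite ?mulr0 // al1 // mulr1.
rewrite mulr_sumr; apply: eq_big_seq => m mS.
have /= -> := Rr 0%N l m isT lS mS; rewrite (IH rows' (fun r => al r.+1)) //; first last.
- by move=> r; apply: al1.
- by move=> r; apply: al0.
- by move=> r l' m' rs; apply: (Rr r.+1).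
- by case: sr.
by rewrite -!mulrA; congr (_ * _); rewrite mulrCA mulKf ?al0.
Qed.

Lemma size_Frows x y (ks : seq F) : size (Frows q x y ks) = size ks.
Proof. by elim: ks x => //= k ks IH x; rewrite IH. Qed.

Lemma nth_Frows x y (ks : seq F) r l m : (r < size ks)%N ->
  nth (fun _ _ => 0) (Frows q x y ks) r l m
  = Frow q (nth 0 ks r) (fun i => x (r + i)%N) y l m.
Proof. by elim: ks x r => // k ks IH x [|r] //= rs; rewrite IH. Qed.

Definition pow_state (z : nat -> F) (l : seq nat) : F :=
  \prod_(i < size l) z i ^+ entry l i.

Definition ratio_state (b : nat -> F) (l : seq nat) : F :=
  \prod_(i < size l) qratio q (b i) (entry l i - entry l i.+1).

Lemma pow_state_neq0 z l : (forall i, z i != 0) -> pow_state z l != 0.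
Proof. by move=> z0; apply/prodf_neq0 => i _; rewrite expf_neq0. Qed.

Lemma pow_state_div z l m : (forall i, z i != 0) -> size m = size l -> incl l m ->
  pow_state z l / pow_state z m = \prod_(i < size l) z i ^+ (entry l i - entry m i).
Proof.
move=> z0 sz /(inclP sz) lm.
rewrite /pow_state sz -prodf_div; apply: eq_bigr => i _.
by rewrite expfB_cond ?(negPf (z0 i)) // lm.
Qed.

(** Redistributes a gauge over horizontal edges: [f 0] goes to the left boundary weight, [f c.+1] to
    the right edge of vertex [c], and the rightmost edge is empty. *)
Lemma big_column_shift (f : nat -> F) n : f n = 1 ->
  f 0%N * \prod_(c < n) f c.+1 = \prod_(c < n) f c.
Proof.
move=> fn; transitivity (\prod_(c < n.+1) f c); first by rewrite big_ord_recl.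
by rewrite big_ord_recr /= fn mulr1.
Qed.

Variables (L B : nat).
Local Notation St := (states L.+1 B).

Lemma Drow_row_weight (u : F) (X S : nat -> F) l m :
  (forall i, X i != 0) -> (forall i, S i != 0) -> l \in St -> m \in St ->
  row_weight (fun a => (- (u * X 0%N * S 0%N)) ^+ a)
             (fun c => wunfused q (u * X c.+1) (S c.+1)) l m
  = pow_state (fun i => X i * S i) l / pow_state (fun i => X i * S i) m
    * Drow q u (fun i => X i.+1 * S i.+1) (fun i => S i.+1 / X i.+1) l m.
Proof.
move=> X0 S0 lS mS; have sz : size m = size l by rewrite !(size_state lS, size_state mS).
rewrite /row_weight; case: (boolP (incl l m)) => lm; last first.
  have := lm; rewrite -has_predC => /hasP[i]; rewrite mem_iota /= add0n => il.
  move=> /negbTE nle; rewrite /Drow /Dprod (bigD1 (Ordinal il)) //=.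
  by rewrite /Dcol nle mul0r !mulr0.
have XS i : X i * S i != 0 by rewrite mulf_neq0.
rewrite (pow_state_div XS sz lm) /Drow /Dprod /row_product.
have h := elimT (inclP sz) lm.
rewrite -(@big_column_shift (fun i => (X i * S i) ^+ (entry l i - entry m i))); last first.
  by rewrite !nth_default ?sz // expr0.
rewrite mulrACA -exprMn -big_split; congr (_ * _).
  by congr (_ ^+ _); ring.
apply: eq_bigr => c _ /=; rewrite /Dcol h /wunfused /Dvertex.
have su : S c.+1 * (u * X c.+1) = u * (X c.+1 * S c.+1) by ring.
have s2 : X c.+1 * S c.+1 * (S c.+1 / X c.+1) = S c.+1 ^+ 2 by field.
rewrite su s2.
case: (entry l c.+1 - entry m c.+1)%N => [|[|b]];
  case: (entry l c - entry m c)%N => [|[|a]] //=;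
  rewrite ?andbF /= ?mulr0 ?mul1r //; case: eqP => _; rewrite ?mulr0 // expr1.
  by rewrite [RHS]mulrA; congr (_ / _); ring.
by rewrite [RHS]mulrA; congr (_ / _); field.
Qed.

Hypothesis q_gen : forall i, q ^+ i.+1 != 1.

Lemma FedgeE (k x : F) a b : k != 0 -> (b <= a)%N ->
  Fedge q k x a b = k ^+ (a - b) * qratio q (x / k) (a - b).
Proof.
move=> k0 ba; rewrite /Fedge ba; elim: (a - b)%N => [|d IH].
  by rewrite big_ord0 qratio0 mul1r.
rewrite big_ord_recr /= IH qratioS [k ^+ d.+1]exprSr.
rewrite (_ : k - x * q ^+ d = k * (1 - x / k * q ^+ d)); first by ring.
by field.
Qed.

(** With t^2 = [x c.+1 / k] one has s^2 / t^2 = [k * y c], so a fused vertex splits into an edge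
    factor, the numerator of [Fcol] and a denominator in [m] alone. The gauge trades the latter for
    a denominator in [l]. *)
Lemma Frow_row_weight (k : F) (z x y : nat -> F) (s : nat -> F) l m :
  k != 0 -> (forall i, z i != 0) -> (forall i, x i != 0) ->
  (forall i, y i = z i.+1) -> (forall c, s c ^+ 2 = x c.+1 * y c) ->
  (forall c i, s c ^+ 2 * q ^+ i != 1) ->
  (forall c i, x c * y c * q ^+ i != 1) ->
  l \in St -> m \in St ->
  row_weight (fun a => (k * z 0%N) ^+ a * qratio q (x 0%N / k) a)
             (fun c => Wfused q (x c.+1 / k) (s c)) l m
  = ratio_state (fun i => x i * y i) l * pow_state z l
    / (ratio_state (fun i => x i.+1 * y i) m * pow_state z m)
    * Frow q k x y l m.
Proof.
move=> k0 z0 x0 yz s2 s_gen xy_gen lS mS.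
have sz : size m = size l by rewrite !(size_state lS, size_state mS).
have [_ _ sl] := and3P (etrans (esym (mem_states L.+1 B l)) lS).
have [_ _ sm] := and3P (etrans (esym (mem_states L.+1 B m)) mS).
have sorted_entry t i : sorted geq t -> (entry t i.+1 <= entry t i)%N.
  move=> /(sortedP 0%N) st; have [il|] := ltnP i.+1 (size t); first exact: st.
  by move=> h; rewrite nth_default.
rewrite /row_weight; case: (boolP (incl l m)) => lm; last first.
  have := lm; rewrite -has_predC => /hasP[i]; rewrite mem_iota /= add0n => il.
  move=> /negbTE nle; rewrite /Frow (bigD1 (Ordinal il)) //=.
  by rewrite /Fedge nle !mul0r !mulr0.
have h := elimT (inclP sz) lm.
rewrite invfM mulrACA (pow_state_div z0 sz lm) /Frow /row_product.
rewrite big_split /= /Fcol prodf_div -/(ratio_state (fun i => x i * y i) l).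
have rl : ratio_state (fun i => x i * y i) l != 0.
  by apply/prodf_neq0 => i _; apply: qratio_neq0.
have rm : ratio_state (fun i => x i.+1 * y i) m != 0.
  by apply/prodf_neq0 => i _; apply: qratio_neq0 => // j; rewrite -s2.
pose f i := z i ^+ (entry l i - entry m i) * Fedge q k (x i) (entry l i) (entry m i).
pose G := \prod_(c < size l) (if (entry l c.+1 <= entry m c)%N
            then qratio q (k * y c) (entry m c - entry l c.+1) else 0).
transitivity (\prod_(c < size l) f c * G / ratio_state (fun i => x i.+1 * y i) m);
  last by rewrite /f big_split /= -/G; field; apply/andP.
rewrite -big_column_shift; last first.
  by rewrite /f !nth_default ?sz // expr0 /Fedge leqnn big_ord0 mulr1.
rewrite -[RHS]mulrA -[RHS]mulrA; congr (_ * _).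
  by rewrite /f FedgeE // exprMn; ring.
rewrite /ratio_state sz /G -prodf_div -big_split; apply: eq_bigr => c _ /=.
have hc := h c; have hc1 := h c.+1; have lc := sorted_entry l c sl.
have mc := sorted_entry m c sm.
rewrite /Wfused (_ : (_ == _)%N = true) /=; last by apply/eqP; lia.
rewrite (_ : (_ <= entry m c - _)%N = (entry l c.+1 <= entry m c)%N); last by lia.
case: leqP => hl; last by rewrite mul0r mulr0.
rewrite (_ : entry m c - entry m c.+1 - (entry l c.+1 - entry m c.+1)
             = entry m c - entry l c.+1)%N; last by lia.
have -> : s c ^+ 2 / (x c.+1 / k) = k * z c.+1.
  by rewrite s2 yz; have := x0 c.+1 => xc0; field; apply/andP.
rewrite /f FedgeE // s2 yz exprMn /qratio.
have := qpochqq_neq0 q_gen (entry m c - entry m c.+1).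
have := qpochqq_neq0 q_gen (entry m c - entry l c.+1).
have := qpochqq_neq0 q_gen (entry l c.+1 - entry m c.+1).
have : qpoch q (x c.+1 * z c.+1) (entry m c - entry m c.+1) != 0.
  by apply: qpoch_neq0 => i; rewrite -yz -s2.
move: (qpoch q _ _) (qpoch q _ _) (qpoch q _ _) (qpoch q _ _) => *; field.
by do ?[apply/andP; split].
Qed.
End Gauge.

Section Vertices.
Variables (F : fieldType) (q : F).

Lemma Wfused_conserve (t2 s : F) i j k l : (i + j)%N != (k + l)%N ->
  Wfused q t2 s i j k l = 0.
Proof. by rewrite /Wfused => /negPf ->. Qed.

Lemma Wfused0 (t2 s : F) : Wfused q t2 s 0 0 0 0 = 1.
Proof. by rewrite /Wfused /= subn0 !qpoch0 expr0 !(mulr1, divr1). Qed.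

Lemma wunfused_conserve (u s : F) i j k l : (i + j)%N != (k + l)%N ->
  wunfused q u s i j k l = 0.
Proof.
rewrite /wunfused => ne.
by do 4!(case: ifP => [/andP[/andP[/eqP ? /eqP ?] /eqP ?]|_]; first by lia).
Qed.

Lemma wunfused0 (u s : F) : s * u != 1 -> wunfused q u s 0 0 0 0 = 1.
Proof.
by move=> su; rewrite /wunfused /= expr0 mulr1 divff // subr_eq0 eq_sym.
Qed.

Lemma wunfused_left (u s : F) i j k l : (1 < j)%N -> wunfused q u s i j k l = 0.
Proof. by case: j => [|[|j]]. Qed.

Lemma eq_row_weight (g g' : nat -> F) w w' l m : g =1 g' ->
  (forall c i j k h, w c i j k h = w' c i j k h) ->
  row_weight g w l m = row_weight g' w' l m.
Proof.
move=> eg ew; rewrite /row_weight /row_product; case: ifP => // _.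
by rewrite eg; congr (_ * _); apply: eq_bigr => j _; rewrite ew.
Qed.

End Vertices.

(** * The two families of functions as chain sums *)

Section Normalisation.
Variables (F : fieldType) (q : F) (Xi S rXi rS : nat -> F).
Hypotheses (rXiE : forall i, rXi i ^+ 2 = Xi i) (rSE : forall i, rS i ^+ 2 = S i)
  (q_gen : forall k, q ^+ k.+1 != 1)
  (Xi_neq0 : forall i, Xi i != 0) (S_neq0 : forall i, S i != 0)
  (S_gen : forall i k, S i.+1 ^+ 2 * q ^+ k != 1)
  (tau_gen : forall r i k, tau rXi rS r i.+1 ^+ 2 * q ^+ k != 1).

Let x i := Xi i.+1 * S i.+1.
Let y i := S i.+1 / Xi i.+1.

(** The fused weights contain s only through its square, so the chosen square roots drop out
    here. *)
Lemma tau_sqr r i : tau rXi rS r i.+1 ^+ 2 = x (r + i) * y i.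
Proof.
by rewrite /tau !exprMn exprVn !rSE !rXiE /x /y addSn [(i + r)%N]addnC; ring.
Qed.

Lemma xy_sqr i : x i * y i = S i.+1 ^+ 2.
Proof. by rewrite /x /y; field. Qed.

Variables (lambda : intpart) (K B : nat).
Hypotheses (sK : (size lambda <= K)%N) (lamB : (part lambda 0 <= B)%N).
Local Notation St := (states K.+1 B).
Local Notation lam := (state_of K.+1 lambda).

Lemma part_out i : (size lambda <= i)%N -> part lambda i = 0%N.
Proof. by move=> h; rewrite /part nth_default. Qed.

Lemma negpow_pad : negpow S lambda = \prod_(i < K.+1) (- S i) ^+ part lambda i.
Proof.
apply: (@prod_ord_pad _ (fun i => (- S i) ^+ part lambda i) _ _ (leqW sK)).
by move=> i /part_out ->; rewrite expr0.
Qed.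

Lemma negpow_neq0 : negpow S lambda != 0.
Proof. by apply/prodf_neq0 => i _; rewrite expf_neq0 // oppr_eq0. Qed.

(** The gauges of the two functions multiply to the product of their normalisations, since the signs
    disappear in the square. *)
Lemma pow_state_negpow :
  pow_state (fun i => Xi i * S i) lam * pow_state (fun i => S i / Xi i) lam
  = negpow S lambda ^+ 2.
Proof.
rewrite negpow_pad -prodrXl /pow_state size_mkseq -big_split.
apply: eq_bigr => i _ /=; rewrite entry_state_of ?(leqW sK) //.
rewrite -exprMn -exprM mulnC exprM sqrrN; congr (_ ^+ _).
by field.
Qed.

Lemma cS_ratio : cS q S lambda = ratio_state q (fun i => x i * y i) lam.
Proof.
rewrite /ratio_state size_mkseq.
rewrite -(@prod_ord_pad _ (fun i => qratio q (x i * y i)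
           (entry lam i - entry lam i.+1)) _ _ (leqW sK)).
  by apply: eq_bigr => i _; rewrite !entry_state_of ?(leqW sK) // xy_sqr.
by move=> i h; rewrite !entry_state_of ?(leqW sK) // part_out // sub0n qratio0.
Qed.

Lemma cS_neq0 : cS q S lambda != 0.
Proof.
by apply/prodf_neq0 => i _; apply: qratio_neq0.
Qed.

Lemma negpow0 T : negpow T empty_part = 1 :> F.
Proof. by rewrite /negpow big_ord0. Qed.

Lemma cS0 T : cS q T empty_part = 1.
Proof. by rewrite /cS big_ord0. Qed.

Let L := maxn (size lambda) (size empty_part).

Let sL : (size lambda <= L)%N. Proof. exact: leq_maxl. Qed.

Let LK : (L <= K)%N. Proof. by rewrite /L maxn0. Qed.

Lemma Ftilde_star_chain_sum m (u : 'I_m -> F) :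
  (forall j i, u j * Xi i.+1 * S i.+1 != 1) ->
  Ftilde_star q Xi S u lambda empty_part
  = pow_state (fun i => Xi i * S i) lam / negpow S lambda
    * chain_sum St (Drows q x y [seq u j | j <- enum 'I_m]) lam.
Proof.
move=> u_gen; rewrite /Ftilde_star /Ftilde !negpow0 !cS0 divr1 !div1r.
rewrite mulrA mulrCA mulfV ?cS_neq0 // mulr1.
have lamS := state_of_states sL LK lamB.
pose g (r : 'I_m) a := (- (u r * Xi 0%N * S 0%N)) ^+ a.
pose wt (r : 'I_m) c := wunfused q (u r * Xi c.+1) (S c.+1).
have wt_cons r c i j k l : (i + j)%N != (k + l)%N -> wt r c i j k l = 0.
  exact: wunfused_conserve.
have wt_pad r c : wt r c 0%N 0%N 0%N 0%N = 1.
  by apply: wunfused0; rewrite mulrC.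
rewrite (_ : \sum_a _ = chain_sum St [seq row_weight (g r) (wt r) | r <- enum 'I_m] lam).
  rewrite [pow_state _ _ / _]mulrC -mulrA; congr (_ * _).
  apply: (@chain_sum_gauge _ _ (fun _ => pow_state (fun i => Xi i * S i))) => //.
  - by rewrite !size_map.
  - move=> r l l' rs lS l'S; rewrite size_map size_enum_ord in rs.
    rewrite -[r]/(nat_of_ord (Ordinal rs)) /Drows -map_comp !nth_map_enum_ord.
    exact: (@Drow_row_weight _ q K B _ Xi S l l' Xi_neq0 S_neq0 lS l'S).
  - by move=> r l _; apply: pow_state_neq0 => i; rewrite mulf_neq0.
  move=> _ l lS l0; rewrite /pow_state big1 // => i _.
  by move: l0 => /(all_nthP 0%N)/(_ i (ltn_ord i))/eqP ->.
have := @lattice_sum_chain_sum F m L K B lambda sL LK lamB wt wt_cons g bool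
  nat_of_bool xpredT wt_pad _ _; apply; first by move=> [] [].
move=> c cS ok Wn0; exists [ffun r : 'I_m => (0 < chain_label K lambda c r)%N] => // r.
(* A left label above 1 would annihilate the first vertex, so a bit records the label faithfully. *)
rewrite ffunE; have [h|] := ltnP 1 (chain_label K lambda c r); last first.
  by case: chain_label => [|[|]].
have := Wn0 r; rewrite /row_product big_ord_recl mulf_eq0 negb_or => /andP[+ _].
by rewrite /wt wunfused_left ?eqxx.
Qed.

(** Telescoping of first parts; at the empty end of a chain this is the constraint a_1 + ... + a_n =
    lambda_1 in [FF]. *)
Lemma chain_label_sum n c k : c \in chains n St -> chain_ok n K lambda c ->
  (k <= n)%N ->
  (\sum_(r < k) chain_label K lambda c r + entry (nth [::] (lam :: c) k) 0
   = part lambda 0)%N.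
Proof.
move=> cS ok; elim: k => [_|k IH kn].
  by rewrite big_ord0 add0n (chain_entry0 sL LK).
rewrite big_ord_recr /= -(IH (ltnW kn)) -addnA; congr (_ + _)%N.
have := chain_ok_incl sL LK lamB 0%N cS ok kn; rewrite /chain_label /=; lia.
Qed.

Lemma FF_chain_sum n (kappa : 'I_n -> F) : (forall i, kappa i != 0) ->
  FF q Xi S rXi rS kappa lambda empty_part
  = pow_state (fun i => S i / Xi i) lam / negpow S lambda
    * chain_sum St (Frows q x y [seq kappa j | j <- enum 'I_n]) lam.
Proof.
move=> kappa_neq0; rewrite /FF !negpow0 !cS0 !div1r.
have lamS := state_of_states sL LK lamB.
pose g (r : 'I_n) a := (kappa r * S 0%N / Xi 0%N) ^+ a
  * (qpoch q ((kappa r)^-1 * S r.+1 * Xi r.+1) a / qpoch q q a).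
pose wt (r : 'I_n) c := Wfused q (Xi (r.+1 + c.+1)%N * S (r.+1 + c.+1)%N / kappa r)
                         (tau rXi rS r.+1 c.+1).
have wt_cons r c i j k l : (i + j)%N != (k + l)%N -> wt r c i j k l = 0.
  exact: Wfused_conserve.
have wt_pad r c : wt r c 0%N 0%N 0%N 0%N = 1 by exact: Wfused0.
(* Above row [r] the parameters have been shifted [r] times. At [r = 0] the [ratio_state] is
   c_S(lambda) and cancels the denominator of [FF]. *)
pose al r l := ratio_state q (fun i => x (r + i)%N * y i) l
               * pow_state (fun i => S i / Xi i) l.
have sk : size [seq kappa j | j <- enum 'I_n] = n by rewrite size_map size_enum_ord.
rewrite (_ : \sum_(_ | _) _ = chain_sum St [seq row_weight (g r) (wt r) | r <- enum 'I_n] lam).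
  rewrite (@chain_sum_gauge _ _ al _ (Frows q x y [seq kappa j | j <- enum 'I_n])) //.
  - rewrite /al cS_ratio -[ratio_state _ (fun i => x i * y i) _]/(ratio_state q (fun i => x (0 + i)%N * y i) lam).
    have := cS_neq0; rewrite cS_ratio => c0; field.
    by apply/andP; split=> //; exact: negpow_neq0.
  - by rewrite size_Frows !size_map.
  - move=> r l l' rs lS l'S; rewrite size_map size_enum_ord in rs.
    rewrite nth_Frows ?sk // -[r]/(nat_of_ord (Ordinal rs)) !nth_map_enum_ord.
    set r' := Ordinal rs.
    rewrite (@eq_row_weight _ _ (fun a => (kappa r' * (S 0%N / Xi 0%N)) ^+ a
        * qratio q (x (r' + 0)%N / kappa r') a) _
        (fun c => Wfused q (x (r' + c.+1)%N / kappa r') (tau rXi rS r'.+1 c.+1))) //.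
      rewrite (@Frow_row_weight _ q K B q_gen _ (fun i => S i / Xi i)
               (fun i => x (r' + i)%N) y (fun c => tau rXi rS r'.+1 c.+1)) //.
      - rewrite /al (_ : (fun i => x (r' + i.+1)%N * y i) = (fun i => x (r'.+1 + i)%N * y i)) //.
        by apply/funext => i; rewrite addnS.
      - by move=> i; rewrite mulf_neq0 ?invr_neq0.
      - by move=> i; rewrite mulf_neq0.
      - by move=> c; rewrite tau_sqr addnS.
      - by move=> c i; rewrite -tau_sqr.
    move=> a; rewrite /g /qratio addn0 /x.
    by congr (_ ^+ _ * (qpoch q _ a / _)); ring.
  - move=> r l _; rewrite mulf_neq0 //.
      by apply/prodf_neq0 => i _; apply: qratio_neq0 => // j; rewrite -tau_sqr.
    by apply: pow_state_neq0 => i; rewrite mulf_neq0 ?invr_neq0.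
  move=> r l lS l0; have e0 i : entry l i = 0%N.
    have [il|il] := ltnP i (size l); last by rewrite nth_default.
    by move: l0 => /(all_nthP 0%N)/(_ i il)/eqP.
  rewrite /al /ratio_state /pow_state !big1 ?mulr1 // => i _; first by rewrite e0.
  by rewrite !e0 qratio0.
rewrite -(@lattice_sum_chain_sum F n L K B lambda sL LK lamB wt wt_cons g
  'I_(part lambda 0).+1 (@nat_of_ord _)
  (fun a => (\sum_i a i + part empty_part 0 == part lambda 0)%N) wt_pad) //.
  exact: ord_inj.
move=> c cS ok _.
have lab_le (r : 'I_n) : (chain_label K lambda c r <= part lambda 0)%N.
  have := chain_label_sum cS ok (ltn_ord r); rewrite big_ord_recr /=; lia.
exists [ffun r : 'I_n => inord (chain_label K lambda c r)] => [|r]; last first.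
  by rewrite ffunE inordK ?ltnS.
have := chain_label_sum cS ok (leqnn n).
rewrite (chain_ok_last 0%N cS ok) => e; apply/eqP; rewrite -[RHS]e.
congr (_ + _)%N.
by apply: eq_bigr => r _; rewrite ffunE inordK ?ltnS.
Qed.
End Normalisation.

(** * Partitions and zero-padded lists *)

Section Partitions.

Lemma part_gt0 (la : intpart) i : (i < size la)%N -> (0 < part la i)%N.
Proof.
have /andP[_ z] := valP la; move=> il; rewrite lt0n; apply/eqP => la0.
by have := mem_nth 0%N il; rewrite -/(part la i) la0 (negPf z).
Qed.

Lemma size_part_le (la : intpart) i : part la i = 0%N -> (size la <= i)%N.
Proof. by rewrite leqNgt => h; apply/negP => /part_gt0; rewrite h. Qed.

Definition part_of (s : seq nat) : intpart :=
  insubd empty_part [seq a <- s | a != 0%N].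

Lemma nth_filter_nonzero (s : seq nat) i : sorted geq s ->
  entry [seq a <- s | a != 0%N] i = entry s i.
Proof.
have geq_trans : transitive geq by move=> a b c ba ac; exact: leq_trans ac ba.
elim: s i => // a s IH i /= sa; have [a0|a0] /= := eqVneq a 0%N; last first.
  by case: i => //= i; exact/IH/(path_sorted sa).
have s0 : all (pred1 0%N) s.
  by apply: sub_all (order_path_min geq_trans sa) => b; rewrite a0 /= leqn0.
rewrite (_ : [seq b <- s | b != 0%N] = [::]).
  rewrite nth_nil a0; case: i => //= i.
  have [il|il] := ltnP i (size s); last by rewrite nth_default.
  by move/(all_nthP 0%N): s0 => /(_ i il)/eqP.
by apply/eqP; rewrite -size_eq0 size_filter -[_ == _]negbK -lt0n -has_count -all_predC;
   apply: sub_all s0 => b /=; rewrite negbK.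
Qed.

Lemma part_part_of s i : sorted geq s -> part (part_of s) i = entry s i.
Proof.
move=> ss; rewrite -nth_filter_nonzero // /part /part_of -[parts _]/(val _) insubdK //.
rewrite unfold_in mem_filter eqxx andbT sorted_filter // => a b c ba ac.
exact: leq_trans ac ba.
Qed.

Lemma state_of_part_of L s : size s = L -> sorted geq s ->
  state_of L (part_of s) = s.
Proof.
move=> sL ss; apply: (@eq_from_nth _ 0%N); rewrite size_mkseq // => i iL.
by rewrite nth_mkseq // part_part_of.
Qed.

Lemma part_of_state_of L (la : intpart) : (size la <= L)%N ->
  part_of (state_of L la) = la.
Proof.
move=> sL; have ss : sorted geq (state_of L la).
  by apply/(sortedP 0%N) => i _; rewrite !entry_state_of //; exact: part_sorted.
have E i : part (part_of (state_of L la)) i = part la i.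
  by rewrite part_part_of // entry_state_of.
apply/val_inj/(@eq_from_nth _ 0%N) => [|i _]; last exact: E.
have out (l1 l2 : intpart) : part l2 =1 part l1 -> (size l2 <= size l1)%N.
  by move=> e; apply: size_part_le; rewrite e /part nth_default.
by apply/eqP; rewrite eqn_leq !out // => j; rewrite E.
Qed.

End Partitions.

Theorem corollary5p12 (F : fieldType) (q : F) (Xi S rXi rS : nat -> F)
    (n m : nat) (kappa : 'I_n -> F) (u : 'I_m -> F)
    (n_gt0 : (0 < n)%N) (m_gt0 : (0 < m)%N)
    (rXiE : forall i, rXi i ^+ 2 = Xi i) (rSE : forall i, rS i ^+ 2 = S i)
    (q_gen : forall k, q ^+ k.+1 != 1)
    (Xi_neq0 : forall i, Xi i != 0) (S_neq0 : forall i, S i != 0)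
    (kappa_neq0 : forall i, kappa i != 0)
    (S_gen : forall i k, S i.+1 ^+ 2 * q ^+ k != 1)
    (tau_gen : forall r i k, tau rXi rS r i.+1 ^+ 2 * q ^+ k != 1)
    (u_gen : forall j i, u j * Xi i.+1 * S i.+1 != 1) :
  finite_set [set lambda : intpart |
    Ftilde_star q Xi S u lambda empty_part
    * FF q Xi S rXi rS kappa lambda empty_part != 0] /\
  \sum_(lambda \in [set: intpart])
     (Ftilde_star q Xi S u lambda empty_part
      * FF q Xi S rXi rS kappa lambda empty_part)
  = \prod_(i < n) \prod_(j < m)
      ((1 - u j * kappa i) / (1 - u j * Xi i.+1 * S i.+1)).
Proof.
pose x i := Xi i.+1 * S i.+1; pose y i := S i.+1 / Xi i.+1.
pose us := [seq u j | j <- enum 'I_m]; pose ks := [seq kappa i | i <- enum 'I_n].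
have sus : size us = m by rewrite size_map size_enum_ord.
have sks : size ks = n by rewrite size_map size_enum_ord.
set f := fun lambda : intpart => _ * _.
pose D K B := chain_sum (states K.+1 B) (Drows q x y us).
pose G K B := chain_sum (states K.+1 B) (Frows q x y ks).
(* Any box containing [la] will do: [supp] uses the smallest one, the summation a box common to all
   contributing partitions. *)
have fE K B (la : intpart) : (size la <= K)%N -> (part la 0 <= B)%N ->
    f la = D K B (state_of K.+1 la) * G K B (state_of K.+1 la).
  move=> sK laB; rewrite /f (Ftilde_star_chain_sum q_gen Xi_neq0 S_neq0 S_gen sK laB u_gen).
  rewrite (FF_chain_sum rXiE rSE q_gen Xi_neq0 S_neq0 S_gen tau_gen sK laB kappa_neq0).
  have /(congr1 (fun z => z / negpow S la ^+ 2)) := pow_state_negpow S Xi_neq0 sK.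
  have np := negpow_neq0 S_neq0 la.
  rewrite divff ?expf_neq0 // => E; rewrite -[RHS]mul1r -E /D /G; field.
  exact: np.
have state_la K B (la : intpart) (sK : (size la <= K)%N) (laB : (part la 0 <= B)%N) :
    state_of K.+1 la \in states K.+1 B by exact: (state_of_states sK (leqnn K) laB).
have supp la : f la != 0 -> (size la <= n)%N /\ (part la 0 <= m)%N.
  rewrite (fE _ _ _ (leqnn _) (leqnn _)) mulf_eq0 negb_or => /andP[Dn Gn].
  have sS := state_la _ _ la (leqnn _) (leqnn _); split.
    by apply: size_part_le; rewrite -(@entry_state_of la (size la).+1) //;
       apply: (Frows_support sS Gn); rewrite sks.
  by rewrite -sus -(@entry_state_of la (size la).+1) //; exact: (Drows_support sS Dn).
have xy_gen r i j : x (i + r)%N * y i * q ^+ j != 1.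
  by rewrite addnC -(tau_sqr rXiE rSE).
have zero_size s : s \in states n.+1 m -> entry s n = 0%N -> (size (part_of s) <= n)%N.
  rewrite mem_states => /and3P[_ _ ss] sn; apply: size_part_le.
  by rewrite part_part_of.
have fpart s : s \in states n.+1 m -> entry s n = 0%N ->
    f (part_of s) = D n m s * G n m s.
  move=> sS sn; have := sS; rewrite mem_states => /and3P[/eqP sz Bs ss].
  rewrite (fE n m) ?zero_size ?state_of_part_of // part_part_of //.
  by apply: (allP Bs); apply: mem_nth; rewrite sz.
have surj la : f la != 0 ->
    exists s, [/\ s \in states n.+1 m, entry s n == 0%N & part_of s = la].
  move=> /supp[sn lm]; exists (state_of n.+1 la); split; first exact: state_la.
    by rewrite entry_state_of ?(leqW sn) // /part nth_default.
  exact/part_of_state_of/leqW.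
split.
  apply: (@sub_finite_set _ _ [set` [seq part_of s | s <- states n.+1 m]]).
    by move=> la /surj[s [sS _ <-]]; rewrite /= map_f.
  exact: finite_seq.
rewrite (@fsbig_image _ _ _ _ f (states n.+1 m) (fun s => entry s n == 0%N) part_of); first last.
- by move=> la _ /surj.
- move=> s t /andP[+ _] /andP[+ _]; rewrite !mem_states.
  move=> /and3P[/eqP sn _ ss] /and3P[/eqP tn _ st] e.
  by rewrite -(state_of_part_of sn ss) -(state_of_part_of tn st) e.
- by [].
- exact: states_uniq.
transitivity (\sum_(s <- states n.+1 m) D n m s * G n m s).
  rewrite [LHS]big_seq_cond; under eq_bigr => s /andP[sS /eqP sn] do rewrite fpart //.
  rewrite -big_seq_cond; apply: big_rmcond_in => s sS sn.
  have [->|Gn] := eqVneq (G n m s) 0; first by rewrite mulr0.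
  by rewrite (Frows_support sS Gn) ?eqxx ?sks in sn.
rewrite (@Drows_Frows _ q n m q_gen) ?sus ?sks //; last first.
  move=> v i /mapP[j _ ->]; rewrite subr_eq0 eq_sym /x mulrA; exact: u_gen.
rewrite big_map big_enum exchange_big; apply: eq_bigr => i _ /=; apply: eq_bigr => j _.
by rewrite nth_map_enum_ord /x mulrA.
Qed.
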